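(* There is an absolute constant $C>0$ such that the following holds for every prime $p>2$. Let $A\subset\mathbb{F}_p^2$ and let $2\le r\le |A|$. If $r\ge\max\left\{2,\frac{16|A|}{p}\right\}$, then $$|\mathcal{L}_r(A)|\le C\left(\frac{|A|^2}{r^3}+\frac{|A|}{r}\right).$$
   Context: $\mathbb{F}_p$ is the field with $p$ elements, $p>2$ prime. $|X|$ denotes the cardinality of a finite set $X$. For $A\subset\mathbb{F}_p^2$ and $2\le r\le|A|$, the set of $r$-rich lines is $\mathcal{L}_r(A):=\{\ell\subset\mathbb{F}_p^2:\ell\text{ is an (affine) line such that }|A\cap\ell|\ge r\}$. *)

(* Defs.v *)
From mathcomp Require Import all_boot all_order all_algebra.
From mathcomp Require Import reals.

Set Implicit Arguments.
Unset Strict Implicit.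
Unset Printing Implicit Defensive.

Import Order.TTheory GRing.Theory Num.Theory.
Local Open Scope ring_scope.

Definition line_through (F : finFieldType) (a v : 'rV[F]_2) : {set 'rV[F]_2} :=
  [set a + t *: v | t : F].

Definition affine_line (F : finFieldType) (l : {set 'rV[F]_2}) : bool :=
  [exists a : 'rV[F]_2, exists v : 'rV[F]_2,
     (v != 0) && (l == line_through a v)].

(* Lines are counted as point sets, so the many parametrisations (a, v) of
   one line contribute a single element.  The richness r may be any real. *)
Definition rich_lines (F : finFieldType) (R : realType) (A : {set 'rV[F]_2})
    (r : R) : {set {set 'rV[F]_2}} :=
  [set l : {set 'rV[F]_2} | affine_line l & r <= #|A :&: l|%:R].

(* Main.v *)
Require Import Defs.
From HB Require Import structures.
From mathcomp Require Import all_boot all_order all_algebra.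
From mathcomp Require Import perm closed_field reals boolp.
From mathcomp Require Import zify ring.
Set Implicit Arguments.
Unset Strict Implicit.
Unset Printing Implicit Defensive.
Import Order.TTheory GRing.Theory Num.Theory.
Local Open Scope ring_scope.

(** The proof is Stepanov's method, applied over the algebraic closure k of F_p
    to the lines y = a x + b. (Vertical lines are disjoint, so at most |A| / r
    of them are r-rich.)

    The auxiliary polynomial Phi(x, y, a) lives on flags: a point (x, y) and
    the slope a of a line through it. A flag has a second system of
    coordinates (a, b, theta): the line y = a x + b and the abscissa theta of
    the point on it. In the latter system Phi is allowed a small degree < m in
    theta, with m about r / 1024, and degrees < e in a and in b, with e about
    7 |A| / r; this gives m e^2 free coefficients. On a line s = (a0, b0) the
    polynomial Phi(x, a0 x + b0, a) is required to be divisible by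
    (a - a0)^t. Its coefficient at (a - a0)^j has degree < m + j in x, so this
    contact of order t costs only t (m + t) linear conditions, although it
    constrains Phi at every point of s. Hence it can be imposed on all the
    r-rich lines simultaneously (stepanov_polynomial).

    Call a point P heavy if at least 2 e / t of these lines pass through P.
    The polynomial Phi(P, a) has degree < 2 e in a and a zero of order t at the
    slope of each such line, so it vanishes identically (zero_of_contacts).
    By double counting, at most two thirds of the rich lines have most of their
    points light.

    The heart of the matter is that heavy points are few (few_zeros). Moving
    the line about a fixed point is the derivation d/da of k[x, y, a]; in the
    coordinates (a, b, theta) it reads d/da - theta d/db, so it raises the
    degree in theta by at most one. Let D_j be the j-th derivative of Phi. All
    the D_j vanish at heavy points. If D_0, D_1, ... have no common factor as
    polynomials in theta over k(a, b), the resultant of D_0 with a combination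
    of D_0, ..., D_(m-1) is a nonzero polynomial in b over k[a], of degree at
    most 3 m e, which vanishes at b = y - a x for each heavy point (x, y); so
    there are at most 3 m e <= |A| / 32 heavy points. A common prime factor of
    D_0, ..., D_(m-1) is stable under the derivation, for otherwise its
    multiplicity would drop by exactly one at each step
    (prime_dvd_iterated_derivation); hence it divides all the D_j, and then the
    coefficients phi_i(x, y) of Phi have a common factor f(x, y)
    (common_factor). Such factors are divided out at the start: contacts
    survive on each line that is not contained in the curve f = 0, and this
    curve contains at most deg_y f lines (remove_common_factors).

    So if A had too many r-rich lines,
      at least one eighth of them would be r/4-rich for
    the set of heavy points, which has at most |A| / 32 elements; induction on
    |A| excludes this (szemeredi_trotter_Fp). The hypothesis r >= 16 |A| / p
    keeps the degree 2 e of Phi below the characteristic, as needed for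
    differentiation to detect multiplicities and coefficients. *)

(** * Divisibility of polynomials over an integral domain *)

Section Divisibility.
Variable R : idomainType.
Implicit Types g p q u : {poly R}.

(** Divisibility of [{poly R}] is that of polynomials over the fraction field
    of [R]: it ignores nonzero constant factors. So this is irreducibility over
    the fraction field, in the form in which it is used. *)
Definition prime_poly g :=
  (1 < size g)%N /\ forall u, g %| u \/ coprimep g u.

Lemma prime_poly_factor p : (1 < size p)%N -> exists2 g, prime_poly g & g %| p.
Proof.
have [n] := ubnP (size p); elim: n p => // n IHn p lepn p_gt1.
have [[u /andP[u_gt1 u_lt]]|noU] :=
  EM (exists u, (1 < size (gcdp p u) < size p)%N).
  have [g gprime g_dvd] := IHn _ (leq_trans u_lt lepn) u_gt1.
  by exists g => //; apply: dvdp_trans g_dvd (dvdp_gcdl _ _).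
exists p => //; split=> // u.
have p_neq0 : p != 0 by rewrite -size_poly_gt0 ltnW.
have [ltg|geg] := ltnP (size (gcdp p u)) (size p).
  right; rewrite /coprimep eqn_leq size_poly_gt0 gcdp_eq0 negb_and p_neq0 andbT.
  by rewrite leqNgt; apply/negP => gt1; apply: noU; exists u; rewrite gt1.
have gp : gcdp p u %= p.
  by rewrite -dvdp_size_eqp ?dvdp_gcdl // eqn_leq geg dvdp_leq ?dvdp_gcdl.
by left; rewrite -(eqp_dvdl _ gp) dvdp_gcdr.
Qed.

Lemma prime_poly_ndvd g u : prime_poly g -> ~~ (g %| u) -> coprimep g u.
Proof. by case=> _ /(_ u)[->|]. Qed.

(** Reduce the [q j] modulo [g]: [g] divides the combination with parameter
    [lam] only if that combination of the remainders is zero, and any nonzero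
    coefficient of it is a nonzero polynomial [chi] in [lam]. *)
Lemma generic_combination_prime g (q : nat -> {poly R}) t :
    prime_poly g -> ~ (forall j, (j <= t)%N -> g %| q j) ->
  exists2 chi : {poly R}, chi != 0 & forall lam, chi.[lam] != 0 ->
    coprimep g (\sum_(j < t.+1) lam ^+ j *: q j).
Proof.
move=> gprime ndvd; have g_neq0 : g != 0 by rewrite -size_poly_gt0 ltnW
  ?gprime.1.
have [j lejt ndvdj] : exists2 j, (j <= t)%N & ~~ (g %| q j).
  apply/not_exists2P => dvd; apply: ndvd => j lejt.
  by have [|/negP] := dvd j; rewrite ?negbK.
(* Pseudo-division multiplies each [q j] by its own power of the leading
   coefficient; the exponent [N] makes these powers equal. *)
pose N := (\max_(j < t.+1) scalp (q j) g)%N.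
pose rho j : {poly R} := lead_coef g ^+ (N - scalp (q j) g) *: (q j %% g).
have lc_neq0 : lead_coef g != 0 by rewrite lead_coef_eq0.
have rhoE (i : 'I_t.+1) : exists u, lead_coef g ^+ N *: q i = u * g + rho i.
  exists (lead_coef g ^+ (N - scalp (q i) g) *: (q i %/ g)).
  rewrite -scalerAl -scalerDr -Pdiv.Idomain.divp_eq scalerA -exprD subnK //.
  by rewrite (leq_bigmax (F := fun j : 'I_t.+1 => scalp (q j) g)).
have rho_neq0 : rho j != 0.
  by rewrite /rho -mul_polyC mulf_neq0 // polyC_eq0 expf_neq0.
have [l rhol] : exists l, (rho j)`_l != 0.
  by exists (size (rho j)).-1; rewrite -lead_coefE lead_coef_eq0.
exists (\poly_(i < t.+1) (rho i)`_l) => [|lam].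
  by apply: contraNneq rhol => /polyP/(_ j);
    rewrite coef_poly coef0 ltnS lejt => ->.
apply: contraTT => ncop.
have dvdq : g %| \sum_(i < t.+1) lam ^+ i *: q i.
  by apply: contraNT ncop; exact: prime_poly_ndvd.
suff rho0 : \sum_(i < t.+1) lam ^+ i *: rho i = 0.
  rewrite negbK horner_poly; apply/eqP.
  have /polyP/(_ l) := rho0; rewrite coef_sum coef0 => E.
  apply: (etrans _ E).
  by apply: eq_bigr => i _; rewrite coefZ mulrC.
apply: contraTeq dvdq => sum_neq0.
have size_sum : (size (\sum_(i < t.+1) lam ^+ i *: rho i)%R < size g)%N.
  rewrite -[(_ < _)%N]/(_ <= _)%N.
  have gt0 : (0 < size g)%N by rewrite size_poly_gt0.
  rewrite -(prednK gt0) ltnS; apply: (leq_trans (size_sum _ _ _)).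
  apply/bigmax_leqP => i _; rewrite (leq_trans (size_scale_leq _ _)) //.
  rewrite (leq_trans (size_scale_leq _ _)) // -ltnS prednK //.
  by rewrite ltn_modp.
apply/negP => dvdq; have : g %| \sum_(i < t.+1) lam ^+ i *: rho i.
  have : g %| lead_coef g ^+ N *: \sum_(i < t.+1) lam ^+ i *: q i.
    by rewrite dvdpZr ?expf_neq0.
  rewrite scaler_sumr (eq_bigr (fun i : 'I_t.+1 =>
    lam ^+ i *: (lead_coef g ^+ N *: q i))) => [|i _]; last first.
    by rewrite !scalerA mulrC.
  have -> : \sum_(i < t.+1) lam ^+ i *: (lead_coef g ^+ N *: q i) =
    \sum_(i < t.+1) lam ^+ i *: (lead_coef g ^+ N *: q i - rho i)
      + \sum_(i < t.+1) lam ^+ i *: rho i.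
    by rewrite -big_split; apply: eq_bigr => i _ /=; rewrite -scalerDr subrK.
  rewrite dvdp_addr //; elim/big_ind: _ => [|x y gx gy|i _]; first exact: dvdp0.
    exact: dvdp_add.
  by have [u ->] := rhoE i; rewrite addrK -mul_polyC !dvdp_mull.
by move/dvdp_leq => /(_ sum_neq0); rewrite leqNgt size_sum.
Qed.

(** Coprimality to [p] can be tested on the finitely many prime factors of [p],
    and each of them excludes finitely many [lam], unless it divides all the
    [q j]. The exceptional set is encoded as the zeros of [chi] so that the
    exceptional sets of two factors are joined by multiplication. *)
Lemma generic_combination_coprime p (q : nat -> {poly R}) t : p != 0 ->
  (exists g, [/\ prime_poly g, g %| p & forall j, (j <= t)%N -> g %| q j]) \/
  (exists2 chi : {poly R}, chi != 0 & forall lam, chi.[lam] != 0 ->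
    coprimep p (\sum_(j < t.+1) lam ^+ j *: q j)).
Proof.
have [n] := ubnP (size p); elim: n p => // n IHn p lepn p_neq0.
have [p_le1|/prime_poly_factor[g gprime g_dvd]] := leqP (size p) 1.
  right; exists 1 => [|lam _]; first exact: oner_neq0.
  have p1 : p %= 1 by rewrite -size_poly_eq1 eqn_leq p_le1 size_poly_gt0.
  by rewrite (eqp_coprimepl _ p1) coprime1p.
have [all_dvd|ndvd] := EM (forall j, (j <= t)%N -> g %| q j).
  by left; exists g.
have [[c h] /= c_neq0 def_p] := Pdiv.Idomain.dvdpP _ _ g_dvd.
have g_gt1 := gprime.1.
have h_neq0 : h != 0.
  apply: contraNneq p_neq0 => h0; move/eqP: def_p.
  by rewrite h0 mul0r -mul_polyC mulf_eq0 polyC_eq0 (negPf c_neq0).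
have ltsz : (size h < n)%N.
  have := size_scale p c_neq0; rewrite def_p size_mul //; last first.
    by rewrite -size_poly_gt0 ltnW.
  by move: g_gt1 lepn; lia.
have [[g' [g'prime g'_dvd g'all]]|[chi chi0 chiP]] := IHn h ltsz h_neq0.
  left; exists g'; split=> //.
  by rewrite -(dvdpZr _ _ c_neq0) def_p dvdp_mulr.
have [chi2 chi20 chi2P] := generic_combination_prime gprime ndvd.
right; exists (chi * chi2); first by rewrite mulf_neq0.
move=> lam; rewrite hornerM mulf_eq0 negb_or => /andP[/chiP cop1 /chi2P cop2].
by rewrite -(coprimepZl _ _ c_neq0) def_p coprimepMl cop1.
Qed.

End Divisibility.

(** * Prime factors stable under a derivation *)

Section DifferentialDivisibility.
Variables (R : idomainType) (nab : {poly R} -> {poly R}).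
Hypothesis nabM : forall u v, nab (u * v) = nab u * v + u * nab v.

Lemma derivation_exp u n : nab (u ^+ n.+1) = (u ^+ n * nab u) *+ n.+1.
Proof.
elim: n => [|n IHn]; first by rewrite expr0 mul1r expr1 mulr1n.
by rewrite exprS nabM IHn mulrnAr mulrA -exprS [nab u * _]mulrC -mulrS.
Qed.

Lemma dvdp_derivation g u : g %| nab g -> g %| u -> g %| nab u.
Proof.
move=> g_nabg /Pdiv.Idomain.dvdpP[[c h] /= c_neq0 def_u].
have /(congr1 nab) := def_u; rewrite -mul_polyC !nabM => E.
rewrite -(dvdpZr _ _ c_neq0) -mul_polyC.
rewrite -(addKr (nab c%:P * u) (c%:P * nab u)) E.
rewrite dvdp_add ?dvdp_add ?dvdpNr ?dvdp_mull //.
by rewrite -(dvdpZr _ _ c_neq0) def_u dvdp_mull.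
Qed.

(** If [g ^ n] divides [u] exactly, then [g ^ n.-1] divides [nab u] exactly, as
    the term [n * g ^ n.-1 * nab g] of the product rule has no further factor
    [g]. *)
Lemma dvdp_exp_derivation g u i : prime_poly g -> ~~ (g %| nab g) ->
    i.+1%:R != 0 :> R -> g ^+ i.+1 %| u -> g ^+ i.+1 %| nab u ->
  g ^+ i.+2 %| u.
Proof.
move=> gprime ndvd i_neq0 dvdu dvdnu.
have g_neq0 : g != 0 by rewrite -size_poly_gt0 ltnW ?gprime.1.
have [[c h] /= c_neq0 def_u] := Pdiv.Idomain.dvdpP _ _ dvdu.
have /(congr1 nab) := def_u; rewrite -mul_polyC !nabM derivation_exp => E.
have : g ^+ i.+1 %| h * ((g ^+ i * nab g) *+ i.+1).
  rewrite -(addKr (nab h * g ^+ i.+1) (h * _)) -E.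
  by rewrite !dvdp_add ?dvdpNr ?dvdp_mull.
rewrite mulrnAr -scaler_nat dvdpZr //.
rewrite mulrCA exprSr dvdp_mul2l ?expf_neq0 // => dvd_nabg.
rewrite -(dvdpZr _ _ c_neq0) def_u exprS dvdp_mul2r ?expf_neq0 //.
by rewrite -(Gauss_dvdpl _ (prime_poly_ndvd gprime ndvd)).
Qed.

(** If [g] did not divide [nab g], each derivative would lower the multiplicity
    of [g] by at most one, so [g ^ mu.+1] would divide [D 0], which is too small
    for that. *)
Lemma prime_dvd_iterated_derivation (D : nat -> {poly R}) g mu :
    (forall j, nab (D j) = D j.+1) -> D 0%N != 0 -> (size (D 0%N) <= mu.+1)%N ->
    (forall i, (0 < i <= mu)%N -> i%:R != 0 :> R) -> prime_poly g ->
    (forall j, (j <= mu)%N -> g %| D j) ->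
  forall j, g %| D j.
Proof.
move=> nabD D0_neq0 szD0 nat_neq0 gprime dvdD.
suff dvdg : g %| nab g.
  by elim=> [|j IHj]; [exact: dvdD | rewrite -nabD dvdp_derivation].
apply/negPn/negP => ndvd.
have dvdX i : (i <= mu)%N -> forall j, (j + i <= mu)%N -> g ^+ i.+1 %| D j.
  elim: i => [|i IHi] lei j leji.
    by rewrite expr1 dvdD // -[j]addn0.
  apply: dvdp_exp_derivation => //; first exact: nat_neq0.
    by apply: IHi; lia.
  by rewrite nabD; apply: IHi; lia.
have /dvdp_leq := dvdX mu (leqnn _) 0%N (leqnn _).
rewrite D0_neq0 => /(_ isT); apply/negP; rewrite -ltnNge.
by have := size_exp g mu.+1; have := gprime.1; move: szD0; nia.
Qed.

End DifferentialDivisibility.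

(** * Elimination of one variable *)

Definition inner_deg_le (K : nzRingType) (B : nat) (p : {poly {poly K}}) :=
  forall i, (size (p`_i)%R <= B.+1)%N.

Section Elimination.
Variable K : idomainType.

Lemma size_det n (M : 'M[{poly K}]_n) B :
  (forall i j, (size (M i j) <= B.+1)%N) -> (size (\det M) <= (n * B).+1)%N.
Proof.
move=> szM; rewrite /determinant (leq_trans (size_sum _ _ _)) //.
apply/bigmax_leqP => s _; rewrite -(rmorph_sign (polyC : K -> _)) mul_polyC.
rewrite (leq_trans (size_scale_leq _ _)) //
  (leq_trans (size_poly_prod_leq _ _)) //.
have : (\sum_(i < n) size (M i (s i)) <= \sum_(i < n) B.+1)%N by apply: leq_sum.
by rewrite sum_nat_const card_ord mulnS leq_subLR addnS ltnS.
Qed.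

Lemma size_resultant (p q : {poly {poly K}}) B :
    inner_deg_le B p -> inner_deg_le B q ->
  (size (resultant p q) <= (((size q).-1 + (size p).-1) * B).+1)%N.
Proof.
move=> szp szq; apply: size_det => i j; rewrite Sylvester_mxE /=.
case: split => l; case: (l <= j)%N; rewrite ?mulr0n ?size_poly0 //.
  exact: szp.
exact: szq.
Qed.

(** The points counted here lie over distinct values of the inner variable,
    and each such value is a root of the resultant. *)
Lemma coprime_common_zeros (p q : {poly {poly K}}) B (s : seq K) :
    inner_deg_le B p -> inner_deg_le B q ->
    p != 0 -> coprimep p q -> uniq s ->
    (forall z, z \in s -> exists t, (map_poly (horner_eval z) p).[t] = 0 /\
                                  (map_poly (horner_eval z) q).[t] = 0) ->
  (size s <= ((size q).-1 + (size p).-1).+1 * B)%N.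
Proof.
move=> szp szq p_neq0 cop s_uniq zeros.
suff [D [D_neq0 szD Dzero]] : exists D : {poly K}, [/\ D != 0,
    (size D <= (((size q).-1 + (size p).-1).+1 * B).+1)%N &
    forall z t, (map_poly (horner_eval z) p).[t] = 0 ->
                (map_poly (horner_eval z) q).[t] = 0 -> root D z].
  rewrite -ltnS; apply: leq_trans szD; apply: max_poly_roots => //.
  by apply/allP => z /zeros[t [p0 q0]]; exact: Dzero p0 q0.
(* The resultant is in the ideal of [p] and [q] only if both are nonconstant;
   a constant polynomial takes the role of the resultant by itself. *)
have szP0 (r : {poly {poly K}}) : (size r <= 1)%N -> inner_deg_le B r ->
  r != 0 -> exists D : {poly K}, [/\ D != 0,
    (size D <= (((size q).-1 + (size p).-1).+1 * B).+1)%N &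
    forall z t, (map_poly (horner_eval z) r).[t] = 0 -> root D z].
  move=> /size1_polyC rE szr; rewrite rE polyC_eq0 => r_neq0; exists r`_0;
    split=> //.
    by rewrite (leq_trans (szr 0%N)) // ltnS leq_pmull.
  by move=> z t; rewrite map_polyC /= hornerC => /eqP.
have [p_le1|p_gt1] := leqP (size p) 1.
  by have [D [? ? HD]] := szP0 p p_le1 szp p_neq0; exists D; split=> // z t /HD.
have [q_le1|q_gt1] := leqP (size q) 1.
  have q_neq0 : q != 0.
    by apply: contraTneq cop => ->;
      rewrite coprimep0 -size_poly_eq1 neq_ltn p_gt1 orbT.
  by have [D [? ? HD]] := szP0 q q_le1 szq q_neq0; exists D;
    split=> // z t _ /HD.
have [[u v] _ /= resE] := resultant_in_ideal p_gt1 q_gt1.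
exists (resultant p q); split.
- by rewrite resultant_eq0 -leqNgt; move: cop; rewrite /coprimep => /eqP ->.
- by rewrite (leq_trans (size_resultant szp szq)) // ltnS leq_mul2r leqnSn orbT.
move=> z t p0 q0; have := congr1 (fun P =>
  (map_poly (horner_eval z) P).[t]) resE.
by rewrite map_polyC /= hornerC rmorphD !rmorphM /= hornerD !hornerM p0 q0
  !mulr0 addr0 => /eqP.
Qed.

End Elimination.

(** * Gauss's lemma over an algebraically closed field *)

Section GaussLemma.
Variable k : closedFieldType.
Implicit Types (c d : {poly k}) (f G h q : {poly {poly k}}).

Lemma closed_field_uniq_seq n : exists2 s : seq k, uniq s & size s = n.
Proof.
elim: n => [|n [s s_uniq sz_s]]; first by exists [::].
have /closed_nonrootP[x] : \prod_(y <- s) ('X - y%:P) != 0 :> {poly k}.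
  by rewrite monic_neq0 // monic_prod_XsubC.
by rewrite root_prod_XsubC => nx; exists (x :: s); rewrite /= ?nx ?sz_s.
Qed.

Lemma dvd_XsubC_coefs G x :
  map_poly (horner_eval x) G = 0 -> exists G', G = ('X - x%:P) *: G'.
Proof.
move=> G0; exists (\poly_(i < size G) (G`_i %/ ('X - x%:P))).
apply/polyP=> i; rewrite coefZ coef_poly.
case: ltnP => [_|/leq_sizeP->]; rewrite ?mulr0 //.
rewrite mulrC divpK // dvdp_XsubCl; apply/eqP.
by have /polyP/(_ i) := G0; rewrite coef_map coef0.
Qed.

(** Over an algebraically closed field, having no nonconstant factor in the
    inner variable means having no factor ['X - x] in it. *)
Definition primitive f := forall x : k, map_poly (horner_eval x) f != 0.

Lemma primitive_part G : G != 0 ->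
  exists d f, [/\ d != 0, G = d *: f & primitive f].
Proof.
have [n] := ubnP (size (lead_coef G)); elim: n G => // n IHn G leGn G_neq0.
have [[x Gx]|prim] := EM (exists x : k, map_poly (horner_eval x) G = 0);
  last first.
  exists 1, G; split; rewrite ?oner_neq0 ?scale1r // => x.
  by apply/eqP => Gx; apply: prim; exists x.
have [G' def_G] := dvd_XsubC_coefs Gx.
have X_neq0 := polyXsubC_eq0 x.
have G'_neq0 : G' != 0 by apply: contraNneq G_neq0; rewrite def_G => ->;
  rewrite scaler0.
have ltG' : (size (lead_coef G') < n)%N.
  move: leGn; rewrite def_G lead_coefZ size_mul ?lead_coef_eq0 ?X_neq0 //.
  by rewrite size_XsubC !ltnS.
have [d [f [d_neq0 def_G' f_prim]]] := IHn _ ltG' G'_neq0.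
exists (('X - x%:P) * d), f; split=> //; first by rewrite mulf_neq0 ?X_neq0.
by rewrite -scalerA -def_G'.
Qed.

(** A root [x] of [c] makes the right-hand side vanish at [x]; as [f] does not
    vanish there, [q] does, and ['X - x] cancels. *)
Lemma primitive_dvd f c h q : primitive f -> c != 0 -> c *: h = q * f ->
  exists q', h = q' * f.
Proof.
move=> f_prim; have [n] := ubnP (size c);
  elim: n c q => // n IHn c q lecn c_neq0 E.
have [c_le1|c_gt1] := leqP (size c) 1.
  have [u u_neq0 def_c] : exists2 u : k, u != 0 & c = u%:P.
    by apply/size_poly1P; rewrite eqn_leq c_le1 size_poly_gt0.
  exists (u^-1%:P *: q); rewrite -scalerAl -E scalerA def_c -polyCM mulVf //.
  by rewrite scale1r.
have /closed_rootP[x] : size c != 1 by rewrite neq_ltn c_gt1 orbT.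
rewrite -dvdp_XsubCl => /divpK def_c.
have : map_poly (horner_eval x) q = 0.
  have /(congr1 (map_poly (horner_eval x))) := E.
  rewrite -mul_polyC !rmorphM /= map_polyC /= -def_c /horner_eval hornerM.
  rewrite hornerXsubC subrr mulr0 mul0r => /esym/eqP.
  by rewrite mulf_eq0 (negPf (f_prim x)) orbF => /eqP.
move=> /dvd_XsubC_coefs[q' def_q].
have X_neq0 : 'X - x%:P != 0 by rewrite polyXsubC_eq0.
have c'_neq0 : c %/ ('X - x%:P) != 0.
  by apply: contraNneq c_neq0 => c0; rewrite -def_c c0 mul0r.
apply: (IHn (c %/ ('X - x%:P)) q') => //.
  by move: lecn; rewrite -{1}def_c size_mul // size_XsubC addn2 !ltnS.
apply: (@mulfI _ ('X - x%:P)%:P); first by rewrite polyC_eq0.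
by rewrite !mul_polyC scalerA mulrC def_c E def_q scalerAl.
Qed.

End GaussLemma.

(** * The two coordinate systems on flags *)

Section Coordinates.
Variable k : fieldType.
Implicit Types (x y a e : k) (phi : {poly {poly k}}) (Phi G : {poly {poly {poly
  k}}}).

(** Substitution of [u] for the variable, through [h] on coefficients. *)
Definition eval_ext (K Q : comNzRingType) (h : {rmorphism K -> Q}) (u : Q) :
    {poly K} -> Q :=
  horner_eval u \o map_poly h.
HB.instance Definition _ K Q h u := GRing.RMorphism.on (@eval_ext K Q h u).

Lemma eval_extC (K Q : comNzRingType) (h : {rmorphism K -> Q}) u c :
  eval_ext h u c%:P = h c.
Proof. by rewrite /eval_ext /= map_polyC /horner_eval hornerC. Qed.

Lemma eval_extX (K Q : comNzRingType) (h : {rmorphism K -> Q}) u :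
  eval_ext h u 'X = u.
Proof. by rewrite /eval_ext /= map_polyX /horner_eval hornerX. Qed.

Arguments eval_ext : simpl never.

Lemma rmorph_poly_ext (K Q : comNzRingType) (f g : {rmorphism {poly K} -> Q}) :
  (forall c, f c%:P = g c%:P) -> f 'X = g 'X -> f =1 g.
Proof.
move=> eqC eqX; elim/poly_ind => [|p c IHp]; first by rewrite !rmorph0.
by rewrite !rmorphD !rmorphM IHp eqC eqX.
Qed.

(** The inner, middle and outer variables. They stand for x, y, a or for
    a, b, theta, according to the coordinate system. *)
Definition v1 : {poly {poly {poly k}}} := 'X%:P%:P.
Definition v2 : {poly {poly {poly k}}} := 'X%:P.
Definition v3 : {poly {poly {poly k}}} := 'X.

Definition const3 : k -> {poly {poly {poly k}}} := polyC \o (polyC \o polyC).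
HB.instance Definition _ := GRing.RMorphism.on const3.

(** For [e = 1] the change of coordinates x = theta, y = b + a theta, a = a,
    from k[x][y][a] to k[a][b][theta], and for [e = -1] its inverse a = a,
    b = y - a x, theta = x. Both exchange the inner and the outer variable. *)
Definition shear e : {poly {poly {poly k}}} -> {poly {poly {poly k}}} :=
  eval_ext (eval_ext (eval_ext const3 v3) (v2 + const3 e * v1 * v3)) v1.
HB.instance Definition _ e := GRing.RMorphism.on (shear e).
Arguments shear : simpl never.

Lemma shear_const e c : shear e c%:P%:P%:P = c%:P%:P%:P.
Proof. by rewrite /shear eval_extC /= eval_extC /= eval_extC. Qed.
Lemma shear1 e : shear e v1 = v3.
Proof. by rewrite /shear eval_extC /= eval_extC /= eval_extX. Qed.
Lemma shear2 e : shear e v2 = v2 + const3 e * v1 * v3.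
Proof. by rewrite /shear eval_extC /= eval_extX. Qed.
Lemma shear3 e : shear e v3 = v1.
Proof. by rewrite /shear eval_extX. Qed.

Opaque eval_ext shear.

Lemma shearK e : cancel (shear e) (shear (- e)).
Proof.
move=> G; rewrite -[RHS]/(idfun G); move: G.
apply: (rmorph_poly_ext (f := shear (- e) \o shear e)) => [c|] /=; last first.
  by rewrite -/v3 shear3 shear1.
move: c; apply: (rmorph_poly_ext (f := (shear (- e) \o shear e) \o polyC)
   (g := polyC)) => [c|] /=; last first.
  rewrite -/v2 shear2 rmorphD !rmorphM /= shear1 shear3 shear2 shear_const
    rmorphN /=.
  by rewrite -!mulrA mulNr [v3 * v1]mulrC subrK.
move: c; apply: (rmorph_poly_ext (f := ((shear (- e) \o shear e) \o polyC) \o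
  polyC)
   (g := polyC \o polyC)) => [c|] /=; last first.
  by rewrite -/v1 shear1 shear3.
by rewrite !shear_const.
Qed.

(** * The derivation fixing a point *)

(** The derivation d/da with x and y constant, seen in the coordinates
    (a, b, theta), where it is d/da - theta d/db. Conjugating the derivation of
    k[x, y][a] gives the product rule for free. *)
Definition flow G := shear 1 (shear (-1) G)^`().

Lemma shearNK : cancel (shear (-1)) (shear 1).
Proof. by move=> G; rewrite -{1}[1]opprK shearK. Qed.

Lemma flow_shear Phi : flow (shear 1 Phi) = shear 1 Phi^`().
Proof. by rewrite /flow shearK. Qed.

Lemma flowM G H : flow (G * H) = flow G * H + G * flow H.
Proof.
have shearM e A B : shear e (A * B) = shear e A * shear e B by exact: rmorphM.
have shearD e A B : shear e (A + B) = shear e A + shear e B by exact: rmorphD.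
by rewrite /flow shearM derivM shearD !shearM !shearNK.
Qed.

Lemma flowD G H : flow (G + H) = flow G + flow H.
Proof. by rewrite /flow rmorphD derivD rmorphD. Qed.

Lemma flow0 : flow 0 = 0.
Proof. by rewrite /flow rmorph0 deriv0 rmorph0. Qed.

Lemma flow_const c : flow c%:P%:P%:P = 0.
Proof. by rewrite /flow shear_const derivC rmorph0. Qed.
Lemma flow1 : flow v1 = 1.
Proof. by rewrite /flow shear1 derivX rmorph1. Qed.
Lemma flow2 : flow v2 = - v3.
Proof.
have dE : (v2 - v1 * v3)^`() = - v1.
  by rewrite derivB derivM [v1^`()]derivC [v2^`()]derivC derivX mulr1 (mul0r
    v3) !add0r.
by rewrite /flow shear2 rmorphN1 mulN1r mulNr dE rmorphN /= shear1.
Qed.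
Lemma flow3 : flow v3 = 0.
Proof. by rewrite /flow shear3 derivC rmorph0. Qed.

(** This is where the coordinates (a, b, theta) matter: the flow kills theta,
    and maps a and b to polynomials of degree at most one in theta. *)
Lemma size_flow G : (size (flow G) <= (size G).+1)%N.
Proof.
have sz1 (c : {poly k}) : (size (flow c%:P%:P) <= 1)%N.
  elim/poly_ind: c => [|c d IHc]; first by rewrite !polyC0 flow0 size_poly0.
  rewrite !rmorphD !rmorphM /= flowD flowM flow_const flow1 addr0 mulr1.
  rewrite (leq_trans (size_polyD _ _)) // geq_max size_polyC_leq1 andbT.
  by rewrite mulrC /v1 mul_polyC (leq_trans (size_scale_leq _ _)).
have sz2 (c : {poly {poly k}}) : (size (flow c%:P) <= 2)%N.
  elim/poly_ind: c => [|c d IHc]; first by rewrite polyC0 flow0 size_poly0.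
  rewrite rmorphD rmorphM /= flowD flowM flow2.
  rewrite (leq_trans (size_polyD _ _)) // geq_max (leq_trans (sz1 _)) // andbT.
  rewrite (leq_trans (size_polyD _ _)) // geq_max.
  rewrite mulrC mul_polyC (leq_trans (size_scale_leq _ _)) //=.
  by rewrite mul_polyC (leq_trans (size_scale_leq _ _)) //
    size_polyN size_polyX.
elim/poly_ind: G => [|G c IHG]; first by rewrite flow0 size_poly0.
rewrite flowD flowM flow3 mulr0 addr0 size_MXaddC.
case: ifP => [/andP[/eqP-> /eqP->]|nz].
  by rewrite flow0 mul0r addr0 size_poly0.
rewrite (leq_trans (size_polyD _ _)) // geq_max (leq_trans (sz2 _)) // andbT.
have [->|fG_neq0] := eqVneq (flow G) 0; first by rewrite mul0r size_poly0.
by rewrite /v3 size_mulX // ltnS.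
Qed.

Lemma size_shear_derivn Phi j :
  (size (shear 1 Phi^`(j)) <= size (shear 1 Phi) + j)%N.
Proof.
elim: j => [|j IHj]; first by rewrite addn0.
by rewrite derivnS -flow_shear addnS (leq_trans (size_flow _)).
Qed.

Lemma inner_deg_leD (K : nzRingType) B (p q : {poly {poly K}}) :
  inner_deg_le B p -> inner_deg_le B q -> inner_deg_le B (p + q).
Proof.
move=> ? ? i; rewrite coefD (leq_trans (size_polyD _ _)) // geq_max.
by apply/andP.
Qed.

Lemma inner_deg_le_sum (K : nzRingType) B I (r : seq I) (P : pred I)
    (F : I -> {poly {poly K}}) :
  (forall i, P i -> inner_deg_le B (F i)) ->
    inner_deg_le B (\sum_(i <- r | P i) F i).
Proof.
move=> bF; elim/big_ind: _ => // [i|p q]; first by rewrite coef0 size_poly0.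
exact: inner_deg_leD.
Qed.

Lemma inner_deg_leM (K : nzRingType) B C (p q : {poly {poly K}}) :
  inner_deg_le B p -> inner_deg_le C q -> inner_deg_le (B + C) (p * q).
Proof.
move=> bp bq i; rewrite coefM (leq_trans (size_sum _ _ _)) //.
apply/bigmax_leqP => j _; rewrite (leq_trans (size_polyMleq _ _)) //.
by have := bp j; have := bq (i - j)%N; lia.
Qed.

Lemma inner_deg_leX (K : nzRingType) B n (p : {poly {poly K}}) :
  inner_deg_le B p -> inner_deg_le (n * B) (p ^+ n).
Proof.
move=> bp; elim: n => [|n IHn]; last by rewrite exprS mulSn;
  apply: inner_deg_leM.
by move=> i; rewrite mul0n expr0 coef1; case: (i == _);
  rewrite ?size_poly1 ?size_poly0.
Qed.

Lemma inner_deg_leW (K : nzRingType) B C (p : {poly {poly K}}) : (B <= C)%N ->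
  inner_deg_le B p -> inner_deg_le C p.
Proof. by move=> leBC bp i; rewrite (leq_trans (bp i)). Qed.

Lemma inner_deg_leC (K : nzRingType) B (c : {poly K}) :
  inner_deg_le B c%:P <-> (size c <= B.+1)%N.
Proof.
split=> [/(_ 0%N)|szc i]; rewrite coefC //=.
by case: (i == _); rewrite ?size_poly0.
Qed.

Lemma inner_deg_le_X (K : nzRingType) B : inner_deg_le B ('X : {poly {poly K}}).
Proof. by move=> i; rewrite coefX; case: (i == _);
  rewrite ?size_poly1 ?size_poly0. Qed.

Lemma inner_deg_le_shear e B Phi : inner_deg_le B Phi ->
  inner_deg_le B (shear e Phi).
Proof.
move=> bPhi; rewrite -[Phi]coefK poly_def rmorph_sum.
apply: inner_deg_le_sum => i _; rewrite -mul_polyC rmorphM rmorphXn /= shear3.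
rewrite -[B]addn0; apply: inner_deg_leM; last first.
  by rewrite -[0%N](muln0 i); apply/inner_deg_leX/inner_deg_leC;
    rewrite size_polyC_leq1.
move: (bPhi i); set phi := Phi`_i => szphi.
rewrite -[phi]coefK poly_def !rmorph_sum; apply: inner_deg_le_sum => j _.
rewrite -mul_polyC 2!rmorphM /= rmorphXn rmorphXn /= -/v2 shear2.
apply: (@inner_deg_leW _ (0 + j * 1));
  first by rewrite add0n muln1 -ltnS (leq_trans (ltn_ord j)).
apply: inner_deg_leM.
  move: phi`_j => c; elim/poly_ind: c => [|c d IHc] i'.
    by rewrite !rmorph0 coef0 size_poly0.
  rewrite !rmorphD !rmorphM /= shear1 shear_const; move: i'.
  apply: inner_deg_leD; last by apply/inner_deg_leC; rewrite size_polyC_leq1.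
  by apply: (@inner_deg_leM _ 0 0) => //; exact: inner_deg_le_X.
apply: inner_deg_leX; apply: inner_deg_leD.
  by apply/inner_deg_leC; rewrite size_polyX.
apply: (@inner_deg_leM _ 1 0); last exact: inner_deg_le_X.
have -> : const3 e * v1 = (e%:P * 'X)%:P%:P by rewrite 2!polyCM.
by apply/inner_deg_leC; rewrite (leq_trans (size_polyC_leq1 _)).
Qed.

Lemma inner_deg_le_derivn B Phi j : inner_deg_le B Phi ->
  inner_deg_le B Phi^`(j).
Proof.
move=> bPhi i; rewrite coef_derivn -mulr_natl -polyC_natr mul_polyC.
by rewrite (leq_trans (size_scale_leq _ _)).
Qed.

End Coordinates.

Opaque eval_ext shear flow.

(** * Common factors of the coefficients *)

Section CommonFactor.
Variable k : closedFieldType.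
Implicit Types (a : k) (phi : {poly {poly k}}) (Phi G : {poly {poly {poly k}}}).

(** The i-th derivative of Phi is i! phi_i plus multiples of the higher
    coefficients by powers of a, so the coefficients are recovered from the
    leading one downwards. *)
Lemma dvdp_shear_coef G Phi : (forall i, (0 < i < size Phi)%N ->
  i%:R != 0 :> k) ->
  (forall j, G %| shear 1 Phi^`(j)) -> forall i, G %| shear 1 (Phi`_i)%:P.
Proof.
move=> nat_neq0 dvdG i; have [n] := ubnP (size Phi - i)%N.
elim: n i => // n IHn i ltn.
have [lei|lti] := leqP (size Phi) i.
  by rewrite nth_default // polyC0 rmorph0 dvdp0.
have fact_neq0 : i`!%:R != 0 :> {poly {poly k}}.
  rewrite -!polyC_natr !polyC_eq0.
  elim: i lti {ltn} => [|i IHi] lti; first by rewrite oner_eq0.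
  by rewrite factS natrM mulf_neq0 ?IHi ?nat_neq0 ?lti //; apply: ltnW.
have := dvdG i; rewrite -[Phi^`(i)]coefK poly_def rmorph_sum.
case sz : (size Phi^`(i)) => [|m].
  have : Phi^`(i)`_0 = 0 by rewrite nth_default ?sz.
  rewrite coef_derivn addn0 ffactnn -mulr_natr => /eqP;
    rewrite mulf_eq0 (negPf fact_neq0) orbF.
  by move=> /eqP-> _; rewrite polyC0 rmorph0 dvdp0.
rewrite big_ord_recl dvdp_addl /=; last first.
  elim/big_ind: _ => [|p q|j _]; [exact: dvdp0|exact: dvdp_add|].
  rewrite -mul_polyC rmorphM dvdp_mulr //= /bump coef_derivn -mulr_natl rmorphM
    rmorphM.
  by rewrite dvdp_mull // IHn //; lia.
rewrite expr0 alg_polyC coef_derivn addn0 ffactnn -mulr_natl !rmorphM /=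
  !rmorph_nat.
by rewrite -(rmorph_nat polyC) mul_polyC dvdpZr.
Qed.

(** The slope is fixed, and b and theta remain. *)
Definition specialize a : {poly {poly {poly k}}} -> {poly {poly k}} :=
  map_poly (map_poly (horner_eval a)).
HB.instance Definition _ a := GRing.RMorphism.on (specialize a).

Definition const2 : k -> {poly {poly k}} := polyC \o polyC.
HB.instance Definition _ := GRing.RMorphism.on const2.

(** At a fixed slope the change of coordinates is an automorphism of the plane,
    with inverse [of_pencil]. *)
Definition to_pencil a : {poly {poly k}} -> {poly {poly k}} :=
  eval_ext (eval_ext const2 'X) ('X%:P + const2 a * 'X).
HB.instance Definition _ a := GRing.RMorphism.on (to_pencil a).

Definition of_pencil a : {poly {poly k}} -> {poly {poly k}} :=
  eval_ext (eval_ext const2 ('X - const2 a * 'X%:P)) 'X%:P.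
HB.instance Definition _ a := GRing.RMorphism.on (of_pencil a).

Lemma specialize1 a : specialize a (v1 k) = const2 a.
Proof. by rewrite /specialize map_polyC /= map_polyC /= /horner_eval hornerX.
  Qed.
Lemma specialize2 a : specialize a (v2 k) = 'X%:P.
Proof. by rewrite /specialize map_polyC /= map_polyX. Qed.
Lemma specialize3 a : specialize a (v3 k) = 'X.
Proof. by rewrite /specialize map_polyX. Qed.
Lemma specialize_const a c : specialize a c%:P%:P%:P = c%:P%:P.
Proof. by rewrite /specialize map_polyC /= map_polyC /= /horner_eval hornerC.
  Qed.

Lemma specialize_shear a phi : specialize a (shear 1 phi%:P) = to_pencil a phi.
Proof.
move: phi; apply: (rmorph_poly_ext (f := (specialize a \o shear 1) \o polyC))
  => [c|] /=; last first.
  rewrite -/(v2 k) shear2 rmorph1 mul1r rmorphD rmorphM /= specialize1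
    specialize2 specialize3.
  by rewrite /to_pencil eval_extX.
move: c; apply: (rmorph_poly_ext (f := ((specialize a \o shear 1) \o polyC) \o
  polyC)
   (g := to_pencil a \o polyC)) => [c|] /=.
  by rewrite shear_const /to_pencil eval_extC /= eval_extC specialize_const.
by rewrite -/(v1 k) shear1 /to_pencil eval_extC /= eval_extX specialize3.
Qed.

Lemma to_pencilK a : cancel (to_pencil a) (of_pencil a).
Proof.
move=> G; rewrite -[RHS]/(idfun G); move: G.
have of_const (c : k) : of_pencil a c%:P%:P = c%:P%:P.
  by rewrite /of_pencil eval_extC /= eval_extC.
have ofX : of_pencil a 'X = 'X%:P by rewrite /of_pencil eval_extX.
apply: (rmorph_poly_ext (f := of_pencil a \o to_pencil a)) => [c|] /=;
  last first.
  rewrite {1}/to_pencil eval_extX rmorphD rmorphM /= of_const ofX.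
  by rewrite /of_pencil eval_extC /= eval_extX subrK.
move: c; apply: (rmorph_poly_ext (f := (of_pencil a \o to_pencil a) \o polyC)
   (g := polyC)) => [c|] /=.
  by rewrite /to_pencil eval_extC /= eval_extC /const2 /= of_const.
by rewrite /to_pencil eval_extC /= eval_extX ofX.
Qed.

Lemma of_pencilK a : cancel (of_pencil a) (to_pencil a).
Proof.
move=> G; rewrite -[RHS]/(idfun G); move: G.
have to_const (c : k) : to_pencil a c%:P%:P = c%:P%:P.
  by rewrite /to_pencil eval_extC /= eval_extC.
have toX : to_pencil a 'X%:P = 'X by rewrite /to_pencil eval_extC /= eval_extX.
apply: (rmorph_poly_ext (f := to_pencil a \o of_pencil a)) => [c|] /=;
  last first.
  by rewrite /of_pencil eval_extX toX.
move: c; apply: (rmorph_poly_ext (f := (to_pencil a \o of_pencil a) \o polyC)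
   (g := polyC)) => [c|] /=.
  by rewrite /of_pencil eval_extC /= eval_extC /const2 /= to_const.
rewrite /of_pencil eval_extC /= eval_extX rmorphB rmorphM /= to_const toX.
by rewrite /to_pencil eval_extX addrK.
Qed.

(** [G] is a common factor of the coefficients phi_i over the field k(a, b)
    only. At a generic numerical slope it becomes a common factor over k(b),
    its primitive part is a common factor over k[b] by Gauss's lemma, and the
    change of coordinates at that slope carries this factor to k[x, y]. *)
Lemma common_factor G Phi : (1 < size G)%N ->
    (forall i, (0 < i < size Phi)%N -> i%:R != 0 :> k) ->
    (forall j, G %| shear 1 Phi^`(j)) ->
  exists f Phi', Phi = f%:P * Phi' /\ (1 < size (shear 1 f%:P))%N.
Proof.
move=> G_gt1 nat_neq0 /(dvdp_shear_coef nat_neq0) dvdG.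
have G_neq0 : G != 0 by rewrite -size_poly_gt0 ltnW.
have /fin_all_exists2[c c_neq0 /fin_all_exists[q qE]] (i : 'I_(size Phi)) :
    exists2 c, c != 0 & exists q, c *: shear 1 (Phi`_i)%:P = q * G.
  have [[c q] /= c_neq0 E] := Pdiv.Idomain.dvdpP _ _ (dvdG i).
  by exists c => //; exists q.
(* A slope is generic if it preserves the degree of [G] and the denominators
   [c i] of the divisibilities. *)
pose d := lead_coef G * \prod_i c i.
have d_neq0 : d != 0.
  by rewrite mulf_neq0 ?lead_coef_eq0 //; apply/prodf_neq0 => i _.
have [a a_good] : exists a, map_poly (horner_eval a) d != 0.
  have /closed_nonrootP[a] : lead_coef d != 0 by rewrite lead_coef_eq0.
  move=> na; exists a; apply: contraNneq na => /polyP/(_ (size d).-1).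
  by rewrite coef_map coef0 => da; apply/eqP.
have spec_c i : map_poly (horner_eval a) (c i) != 0.
  move: a_good; rewrite rmorphM rmorph_prod mulf_eq0 negb_or => /andP[_].
  by move/prodf_neq0; apply.
have spec_G : (1 < size (specialize a G))%N.
  rewrite /specialize size_map_poly_id0 //.
  by move: a_good; rewrite rmorphM mulf_eq0 negb_or => /andP[].
have [e [f [e_neq0 def_G f_prim]]] : exists e f, [/\ e != 0,
  specialize a G = e *: f & primitive f].
  by apply: primitive_part; rewrite -size_poly_gt0 ltnW.
have /fin_all_exists[h hE] (i : 'I_(size Phi)) : exists h,
  to_pencil a Phi`_i = h * f.
  apply: (primitive_dvd f_prim (spec_c i) (q := e%:P * specialize a (q i))).
  rewrite -specialize_shear mulrAC mul_polyC -def_G mulrC -rmorphM -qE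
    -!mul_polyC rmorphM /=.
  by rewrite {2}/specialize map_polyC.
exists (of_pencil a f), (\sum_(i < size Phi) (of_pencil a (h i))%:P * 'X^i);
  split.
  rewrite -{1}[Phi]coefK poly_def big_distrr /=; apply: eq_bigr => i _.
  have fE : Phi`_i = of_pencil a f * of_pencil a (h i).
    by rewrite -rmorphM [f * _]mulrC -hE /= to_pencilK.
  by rewrite -mul_polyC [in LHS]fE polyCM mulrA.
apply: (leq_trans spec_G); rewrite def_G size_scale // -{1}[f](of_pencilK a).
by rewrite -specialize_shear size_poly.
Qed.

End CommonFactor.

(** * Points at which the auxiliary polynomial vanishes *)

Section FewZeros.
Variable k : closedFieldType.
Implicit Types (x y : k) (phi : {poly {poly k}}) (Phi G : {poly {poly {poly
  k}}}).

(** Phi(x, y, a) as a polynomial in a. *)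
Definition at_point x y : {poly {poly {poly k}}} -> {poly k} :=
  map_poly (horner_eval x \o horner_eval y%:P).
HB.instance Definition _ x y := GRing.RMorphism.on (at_point x y).

(** The value at theta = x, b = y - a x: the same restriction, in the
    coordinates (a, b, theta). *)
Definition on_lift x y : {poly {poly {poly k}}} -> {poly k} :=
  horner_eval x%:P \o map_poly (horner_eval (y%:P - x *: 'X)).
HB.instance Definition _ x y := GRing.RMorphism.on (on_lift x y).

Lemma on_lift_shear x y Phi : on_lift x y (shear 1 Phi) = at_point x y Phi.
Proof.
have lift3 : on_lift x y (v3 k) = x%:P.
  by rewrite /on_lift /= map_polyX /horner_eval hornerX.
have lift2 : on_lift x y (v2 k) = y%:P - x *: 'X.
  by rewrite /on_lift /= map_polyC /= /horner_eval hornerC hornerX.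
have lift1 : on_lift x y (v1 k) = 'X.
  by rewrite /on_lift /= map_polyC /= /horner_eval !hornerC.
move: Phi; apply: (rmorph_poly_ext (f := on_lift x y \o shear 1)) => [c|] /=;
  last first.
  by rewrite -/(v3 k) shear3 lift1 /at_point map_polyX.
move: c; apply: (rmorph_poly_ext (f := (on_lift x y \o shear 1) \o polyC)
  (g := at_point x y \o polyC)) => [c|] /=; last first.
  rewrite -/(v2 k) shear2 rmorph1 mul1r rmorphD rmorphM /= lift1 lift2 lift3.
  by rewrite mulrC mul_polyC subrK /at_point map_polyC /= /horner_eval hornerX
    hornerC.
move: c; apply: (rmorph_poly_ext (f := ((on_lift x y \o shear 1) \o polyC) \o
  polyC)
  (g := (at_point x y \o polyC) \o polyC)) => [c|] /=; last first.
  rewrite -/(v1 k) shear1 lift3 /at_point map_polyC /= /horner_eval hornerC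
    hornerX //.
rewrite shear_const /at_point map_polyC /= /on_lift /= map_polyC /=.
by rewrite /horner_eval !hornerC.
Qed.

Lemma at_point_derivn x y Phi j : at_point x y Phi = 0 ->
  at_point x y Phi^`(j) = 0.
Proof. by rewrite /at_point -derivn_map => ->; rewrite derivnC; case: j. Qed.

(** A point at which Phi vanishes for every slope is a common zero of all the
    derivatives of Phi, at theta = x and b = y - a x; distinct points give
    distinct values of b in k[a], so elimination of theta bounds their number.
    The hypothesis on factors makes the derivatives coprime. *)
Lemma few_zeros Phi B mu (Z : seq (k * k)) :
    Phi != 0 -> inner_deg_le B Phi -> (size (shear 1 Phi) <= mu.+1)%N ->
    (forall i, (0 < i < size Phi)%N -> i%:R != 0 :> k) ->
    (forall i, (0 < i <= mu)%N -> i%:R != 0 :> k) ->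
    (forall f Phi', Phi = f%:P * Phi' -> (size (shear 1 f%:P) <= 1)%N) ->
    uniq Z -> (forall P, P \in Z -> at_point P.1 P.2 Phi = 0) ->
  (size Z <= (3 * mu).+1 * B)%N.
Proof.
move=> Phi_neq0 degPhi szPhi char_deg char_mu nofactor Z_uniq Zzero.
pose D j := shear 1 Phi^`(j).
have D0_neq0 : D 0%N != 0 by rewrite /D derivn0 (can2_eq (shearK _) (shearNK (k
  := k))) rmorph0.
have inner_D j : inner_deg_le B (D j).
  by apply/inner_deg_le_shear/inner_deg_le_derivn.
have natP2 i : i%:R != 0 :> k -> i%:R != 0 :> {poly {poly k}}.
  by rewrite -!polyC_natr !polyC_eq0.
have [[g [gprime _ gdvd]]|[chi chi_neq0 chiP]] := generic_combination_coprime D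
  mu D0_neq0.
  have dvdD : forall j, g %| D j.
    apply: (prime_dvd_iterated_derivation (@flowM k) _ D0_neq0 szPhi _ gprime
      gdvd).
      by move=> j; rewrite flow_shear -derivnS.
    by move=> i /char_mu/natP2.
  have [f [Phi' [/nofactor]]] := common_factor gprime.1 char_deg dvdD.
  by rewrite leqNgt => /negP.
have [lam lamP] : exists lam : k, chi.[lam%:P%:P] != 0.
  have [s s_uniq sz_s] := closed_field_uniq_seq k (size chi).
  apply/not_existsP => all0.
  have := max_poly_roots (rs := [seq lam%:P%:P | lam <- s]) chi_neq0.
  rewrite size_map sz_s ltnn map_inj_uniq // =>
    [/(_ _ s_uniq) H|a b /polyC_inj/polyC_inj //].
  suff : false by []; apply: H; apply/allP => _ /mapP[lam _ ->].
  by apply: contrapT => lamP; apply: (all0 lam); apply/eqP => lam0;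
    apply: lamP; apply/eqP.
pose q := \sum_(j < mu.+1) lam%:P%:P ^+ j *: D j.
have cop : coprimep (D 0%N) q by apply: chiP.
have inner_q : inner_deg_le B q.
  apply: inner_deg_le_sum => j _ i; rewrite coefZ -!rmorphXn mul_polyC.
  by rewrite (leq_trans (size_scale_leq _ _)) // inner_D.
have szq : (size q <= (2 * mu).+1)%N.
  rewrite (leq_trans (size_sum _ _ _)) //; apply/bigmax_leqP => j _.
  rewrite (leq_trans (size_scale_leq _ _)) //
    (leq_trans (size_shear_derivn _ _)) //.
  by have := ltn_ord j; lia.
pose zeta (P : k * k) : {poly k} := P.2%:P - P.1 *: 'X.
have zeta_inj : injective zeta.
  move=> [x y] [x' y'] /polyP E; have := E 0%N; have := E 1%N.
  rewrite !coefB !coefC !coefZ !coefX /= !mulr1 !mulr0 !subr0 !sub0r.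
  by move=> /oppr_inj-> ->.
have lift_D P j : P \in Z -> on_lift P.1 P.2 (D j) = 0.
  by move=> PZ; rewrite on_lift_shear at_point_derivn ?Zzero.
have := coprime_common_zeros (s := map zeta Z) (inner_D 0%N) inner_q D0_neq0
  cop.
rewrite map_inj_uniq // size_map => /(_ Z_uniq) bound.
apply: leq_trans (bound _) _.
  move=> _ /mapP[P PZ ->]; exists P.1%:P; split; first exact: lift_D.
  change (on_lift P.1 P.2 q = 0); rewrite rmorph_sum big1 //= => j _.
  by rewrite -mul_polyC rmorphM /= lift_D ?mulr0.
have szD : (size (D 0%N) <= mu.+1)%N by rewrite /D derivn0.
rewrite leq_mul2r; apply/orP; right.
by move: szD szq; move: (size (D _)) (size q) => m n; lia.
Qed.
End FewZeros.

(** * Contact with lines *)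

Section Contact.
Variable k : closedFieldType.
Implicit Types (s : k * k) (f : {poly {poly k}}) (Phi : {poly {poly {poly k}}}).

Definition line_poly s : {poly k} := s.1 *: 'X + s.2%:P.

(** Phi(x, a0 x + b0, a) for the line s = (a0, b0). *)
Definition on_line s : {poly {poly {poly k}}} -> {poly {poly k}} :=
  map_poly (horner_eval (line_poly s)).
HB.instance Definition _ s := GRing.RMorphism.on (on_line s).

Lemma on_line1 s : on_line s (v1 k) = 'X%:P.
Proof. by rewrite /on_line map_polyC /= /horner_eval hornerC. Qed.
Lemma on_line2 s : on_line s (v2 k) = (line_poly s)%:P.
Proof. by rewrite /on_line map_polyC /= /horner_eval hornerX. Qed.
Lemma on_line3 s : on_line s (v3 k) = 'X.
Proof. by rewrite /on_line map_polyX. Qed.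
Lemma on_line_const s c : on_line s (const3 c) = c%:P%:P.
Proof. by rewrite /on_line /const3 /= map_polyC /= /horner_eval hornerC. Qed.

(** The modulus is monic, so this divisibility over the fraction field of k[x]
    is the one in k[x][a]. *)
Definition contact m s Phi := ('X - s.1%:P%:P) ^+ m %| on_line s Phi.

Lemma line_poly_inj : injective line_poly.
Proof.
move=> [x y] [x' y'] /polyP E; have := E 0%N; have := E 1%N.
rewrite !coefD !coefC !coefZ !coefX /= !mulr1 !mulr0 !addr0 !add0r.
by move=> -> ->.
Qed.

Lemma at_point_on_line s x Phi :
  at_point x (s.1 * x + s.2) Phi = map_poly (horner_eval x) (on_line s Phi).
Proof.
rewrite /at_point /on_line -map_poly_comp; apply: eq_map_poly => phi /=.
change (horner_eval x phi.[(s.1 * x + s.2)%:P] = horner_eval x phi.[line_poly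
  s]).
rewrite -!horner_map /= /horner_eval hornerC.
by rewrite /line_poly hornerD hornerZ hornerX hornerC.
Qed.

Lemma contact_at_point m s x Phi :
  contact m s Phi -> ('X - s.1%:P) ^+ m %| at_point x (s.1 * x + s.2) Phi.
Proof.
rewrite /contact at_point_on_line => dvd.
have [q ->] := Pdiv.IdomainMonic.dvdpP (monic_exp m (monicXsubC s.1%:P)) _ dvd.
rewrite rmorphM rmorphXn rmorphB /= map_polyX map_polyC /= /horner_eval hornerC.
exact: dvdp_mull.
Qed.

Lemma dvdp_prod_XsubC_exp m (rs : seq k) (p : {poly k}) : uniq rs ->
  (forall a, a \in rs -> ('X - a%:P) ^+ m %| p) ->
    \prod_(a <- rs) ('X - a%:P) ^+ m %| p.
Proof.
elim: rs => [|a rs IHrs] /=; first by rewrite big_nil dvd1p.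
move=> /andP[a_notin rs_uniq] dvd; rewrite big_cons Gauss_dvdp.
  by rewrite dvd ?mem_head // IHrs // => b b_in; apply: dvd;
    rewrite inE b_in orbT.
by rewrite coprimep_expl // prodrXl coprimep_expr //
  coprimep_sym coprimep_XsubC root_prod_XsubC.
Qed.

(** The lines through a point have distinct slopes, so their contacts produce
    coprime factors of a polynomial of smaller degree. *)
Lemma zero_of_contacts m Phi x y (ss : seq (k * k)) : uniq ss ->
    (forall s, s \in ss -> y = s.1 * x + s.2 /\ contact m s Phi) ->
    (size Phi <= m * size ss)%N ->
  at_point x y Phi = 0.
Proof.
move=> ss_uniq ssP szPhi; apply/eqP/negPn/negP => nz.
have : \prod_(a <- [seq s.1 | s <- ss]) ('X - a%:P) ^+ m %| at_point x y Phi.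
  apply: dvdp_prod_XsubC_exp => [|_ /mapP[s /ssP[-> c] ->]];
    last exact: contact_at_point.
  rewrite map_inj_in_uniq // => [[a b] [a' b']] /ssP[/= E _] /ssP[/= E' _] aa'.
  by move: E'; rewrite E aa' => /addrI->.
move=> /dvdp_leq => /(_ nz); rewrite prodrXl; apply/negP; rewrite -ltnNge.
have -> : size ((\prod_(a <- [seq s.1 | s <- ss]) ('X - a%:P)) ^+ m) = (m *
  size ss).+1.
  rewrite -(prednK (n := size _)) ?size_exp ?size_prod_XsubC ?size_map //.
    by rewrite mulnC.
  by rewrite size_poly_gt0 expf_neq0 // monic_neq0 // monic_prod_XsubC.
by rewrite ltnS (leq_trans (size_poly _ _)).
Qed.

Lemma contact_cofactor m s f Phi' : contact m s (f%:P * Phi') ->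
  f.[line_poly s] != 0 -> contact m s Phi'.
Proof.
rewrite /contact rmorphM /= {1}/on_line map_polyC /= /horner_eval mul_polyC.
by move=> dvd nz; rewrite -(dvdpZr _ _ nz).
Qed.

Lemma lines_in_curve (I : finType) (ln : I -> k * k) (S : {set I}) f :
  injective ln -> f != 0 -> (forall i, i \in S -> f.[line_poly (ln i)] = 0) ->
  (#|S| <= (size f).-1)%N.
Proof.
move=> ln_inj f_neq0 Szero; rewrite -ltnS prednK ?size_poly_gt0 //.
have := max_poly_roots (rs := [seq line_poly (ln i) | i <- enum S]) f_neq0.
rewrite size_map -cardE; apply.
  by apply/allP => z /mapP[i]; rewrite mem_enum => iS ->; apply/eqP/Szero.
by rewrite map_inj_uniq ?enum_uniq // => i j /line_poly_inj/ln_inj.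
Qed.

(** The factor [f] is measured in theta because this degree decreases when [f]
    is divided out. *)
Definition no_common_factor Phi :=
  forall f Phi', Phi = f%:P * Phi' -> (size (shear 1 f%:P) <= 1)%N.

(** Dividing out [f] spoils the contact with the lines contained in f = 0 only.
    These are at most deg_y f, and this is the loss in [B], so the total number
    of lost lines is bounded by the initial [B]. *)
Lemma remove_common_factors (I : finType) (ln : I ->
  k * k) (S : {set I}) m B Phi :
    injective ln -> Phi != 0 -> inner_deg_le B Phi ->
    (forall i, i \in S -> contact m (ln i) Phi) ->
  exists Phi' (S' : {set I}) B', [/\ Phi' != 0, no_common_factor Phi',
    S' \subset S,
    (#|S| + B' <= #|S'| + B)%N & inner_deg_le B' Phi'] /\
   [/\ (size Phi' <= size Phi)%N, (size (shear 1 Phi') <= size (shear 1 Phi))%N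
     &
    forall i, i \in S' -> contact m (ln i) Phi'].
Proof.
move=> ln_inj; have [n] := ubnP (size (shear 1 Phi)).
elim: n Phi S B => // n IHn Phi S B len Phi_neq0 degPhi SPhi.
have [nf|] := EM (no_common_factor Phi); first by exists Phi, S, B.
move=> /existsNP[f /existsNP[Phi1 /not_implyP[def_Phi /negP]]];
  rewrite -ltnNge => szf.
have f_neq0 : f != 0 by apply: contraNneq Phi_neq0; rewrite def_Phi => ->;
  rewrite mul0r.
have Phi1_neq0 : Phi1 != 0.
  by apply: contraNneq Phi_neq0; rewrite def_Phi => ->; rewrite mulr0.
have sPhi1_neq0 : shear 1 Phi1 != 0.
  by rewrite (can2_eq (shearK _) (shearNK (k := k))) rmorph0.
have coefPhi i : Phi`_i = f * Phi1`_i by rewrite def_Phi coefCM.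
have szf_gt0 : (0 < size f)%N by rewrite size_poly_gt0.
have degf : ((size f).-1 <= B)%N.
  have nz : Phi1`_(size Phi1).-1 != 0 by rewrite -lead_coefE lead_coef_eq0.
  have := degPhi (size Phi1).-1; rewrite coefPhi size_mul //.
  rewrite -size_poly_gt0 in nz; move: nz szf_gt0.
  by move: (size f) (size (Phi1`_(size Phi1).-1)%R) => u v; lia.
have degPhi1 : inner_deg_le (B - (size f).-1) Phi1.
  move=> i; have [->|nz] := eqVneq Phi1`_i 0; first by rewrite size_poly0.
  have := degPhi i; rewrite coefPhi size_mul //; move: szf_gt0 degf.
  by move: (size f) (size (Phi1`_i)%R) => u v; lia.
pose S1 := [set i in S | f.[line_poly (ln i)] != 0].
have S1S : S1 \subset S by apply/subsetP => i; rewrite inE => /andP[].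
have cardS1 : (#|S| <= #|S1| + (size f).-1)%N.
  rewrite -leq_subLR -cardsDS //; apply: (lines_in_curve ln_inj) => // i.
  by rewrite !inE => /andP[+ iS]; rewrite iS negbK => /eqP.
have szPhi1 : (size (shear 1 Phi1) < size (shear 1 Phi))%N.
  have sf_neq0 : shear 1 f%:P != 0 by rewrite -size_poly_gt0 ltnW.
  have -> : shear 1 Phi = shear 1 f%:P * shear 1 Phi1 by rewrite def_Phi;
    exact: rmorphM.
  rewrite (size_mul sf_neq0 sPhi1_neq0).
  have ltD u v : (1 < u)%N -> (0 < v)%N -> (v < (u + v).-1)%N by lia.
  by apply: ltD; rewrite ?size_poly_gt0.
have [|i|Phi' [S' [B' [[nz' nf' sS' cS' deg'] [sz1 sz2 con']]]]] :=
    IHn Phi1 S1 (B - (size f).-1)%N _ Phi1_neq0 degPhi1.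
- by rewrite (leq_trans szPhi1).
- rewrite inE => /andP[iS nz]; apply: (contact_cofactor (f := f)) => //.
  by rewrite -def_Phi SPhi.
have cS : (#|S| + B' <= #|S'| + B)%N.
  by move: cS' cardS1 degf; move: (size f) => u; lia.
have sz1' : (size Phi' <= size Phi)%N by rewrite (leq_trans sz1) //
  def_Phi size_Cmul.
have sz2' := leq_trans sz2 (ltnW szPhi1).
exact: (ex_intro _ Phi' (ex_intro _ S' (ex_intro _ B' (conj
  (And5 nz' nf' (subset_trans sS' S1S) cS deg') (And3 sz1' sz2' con'))))).
Qed.

End Contact.

Opaque on_line.

(** * Construction of the auxiliary polynomial *)

Lemma underdetermined (k : fieldType) (I J : finType) (M : I -> J -> k) :
  (#|J| < #|I|)%N ->
  exists2 c : I -> k, exists i, c i != 0 & forall j, \sum_i c i * M i j = 0.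
Proof.
move=> ltJI; pose A := \matrix_(i < #|I|, j < #|J|) M (enum_val i) (enum_val j).
have : kermx A != 0.
  rewrite kermx_eq0 /row_free neq_ltn.
  by rewrite (leq_ltn_trans (rank_leq_col A)).
case/matrix0Pn => i0 [j0 nz]; exists (fun i => kermx A i0 (enum_rank i)).
  by exists (enum_val j0); rewrite enum_valK.
move=> j; have /matrixP/(_ i0 (enum_rank j)) := mulmx_ker A.
rewrite mxE [RHS]mxE => E; rewrite -[RHS]E.
rewrite (reindex (fun i : 'I_#|I| => enum_val i)) /=; last first.
  by exists enum_rank => i _; rewrite ?enum_valK ?enum_rankK.
by apply: eq_bigr => i _; rewrite enum_valK [A _ _]mxE enum_rankK.
Qed.

Section Stepanov.
Variable k : closedFieldType.
Implicit Types (s : k * k) (p q : {poly {poly k}}).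

(** The coefficient at the i-th power of a - a0 has degree at most D + i in x:
    a grows out of a0 and b out of b0 - x (a - a0) along a line. *)
Definition staircase D p := forall i, (size (p`_i)%R <= D + i.+1)%N.

Lemma staircaseM D E p q : staircase D p -> staircase E q ->
  staircase (D + E) (p * q).
Proof.
move=> sp sq i; rewrite coefM (leq_trans (size_sum _ _ _)) //.
apply/bigmax_leqP => j _; rewrite (leq_trans (size_polyMleq _ _)) //.
by have := sp j; have := sq (i - j)%N; have := ltn_ord j; lia.
Qed.

Lemma staircaseX p n : staircase 0 p -> staircase 0 (p ^+ n).
Proof.
move=> sp; elim: n => [|n IHn]; last by rewrite exprS; apply: (@staircaseM 0 0).
by move=> i; rewrite expr0 coef1; case: (i == _);
  rewrite ?size_poly1 ?size_poly0.
Qed.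

Definition monomial (u v l : nat) : {poly {poly {poly k}}} :=
  v1 k ^+ u * v2 k ^+ v * v3 k ^+ l.

(** The monomial a^u b^v theta^l along the line [s], in powers of a - a0. *)
Definition line_monomial s (u v l : nat) : {poly {poly k}} :=
  ('X + s.1%:P%:P) ^+ u * (s.2%:P%:P - 'X%:P * 'X) ^+ v * ('X ^+ l)%:P.

Lemma staircase_line_monomial s u v l : staircase l (line_monomial s u v l).
Proof.
apply: (@staircaseM 0 l); last first.
  by move=> i; rewrite coefC; case: (i == _);
    rewrite ?size_polyXn ?size_poly0; lia.
apply: (@staircaseM 0 0); apply: staircaseX => -[|[|i]].
- by rewrite coefD coefX coefC add0r (leq_trans (size_polyC_leq1 _)).
- by rewrite coefD coefX coefC addr0 size_poly1.
- by rewrite coefD coefX coefC addr0 size_poly0.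
- by rewrite coefB coefMX coefC subr0 (leq_trans (size_polyC_leq1 _)).
- by rewrite coefB coefCM coefX coefC sub0r mulr1 size_polyN size_polyX.
- by rewrite coefB coefCM coefX coefC sub0r mulr0 size_polyN size_poly0.
Qed.

Lemma on_line_monomial s u v l :
  on_line s (shear (-1) (monomial u v l)) =
    line_monomial s u v l \Po ('X - s.1%:P%:P).
Proof.
pose F (A : {poly {poly {poly k}}}) := on_line s (shear (-1) A).
have FM A B : F (A * B) = F A * F B by rewrite /F !rmorphM.
have FX A n : F (A ^+ n) = F A ^+ n by rewrite /F !rmorphXn.
have F1 : F (v1 k) = 'X by rewrite /F shear1 on_line3.
have F3 : F (v3 k) = 'X%:P by rewrite /F shear3 on_line1.
have F2 : F (v2 k) = (line_poly s)%:P - 'X%:P * 'X.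
  rewrite /F shear2 rmorphD !rmorphM /= on_line1 on_line2 on_line3
    on_line_const.
  by rewrite 2!polyCN !mulNr mul1r.
rewrite -[LHS]/(F (monomial u v l)) /monomial /line_monomial !FM !FX F1 F2 F3.
rewrite comp_polyM comp_polyM !rmorphXn /= comp_polyD comp_polyX comp_polyC
  subrK.
rewrite comp_polyB comp_polyM !comp_polyC comp_polyX.
congr (_ * _ ^+ _ * _).
by rewrite /line_poly polyCD -mul_polyC polyCM mulrBr; ring.
Qed.

Lemma monomialE c u v l : const3 c * monomial u v l =
  ((c%:P * 'X^u)%:P * 'X^v)%:P * 'X^l :> {poly {poly {poly k}}}.
Proof. by rewrite /monomial /v1 /v2 /v3 !polyCM !rmorphXn /= !mulrA. Qed.

Lemma coef_monomial c u v l u' v' l' :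
  (((const3 c * monomial u v l)`_l')`_v')`_u' =
    c * (u' == u)%:R * (v' == v)%:R * (l' == l)%:R.
Proof.
rewrite monomialE coefCM coefXn; case: (l' == l); last by rewrite !mulr0 !coef0.
rewrite mulr1 coefCM coefXn; case: (v' == v);
  last by rewrite !mulr0 !coef0 mul0r.
by rewrite !mulr1 coefCM coefXn.
Qed.

Lemma inner_deg_le_monomial c u v l e : (v < e)%N ->
  inner_deg_le e.-1 (const3 c * monomial u v l).
Proof.
move=> ltve; rewrite monomialE -[e.-1]addn0; apply: inner_deg_leM; last first.
  by rewrite -[0%N](muln0 l); apply/inner_deg_leX/inner_deg_le_X.
apply/inner_deg_leC; rewrite mul_polyC (leq_trans (size_scale_leq _ _)) //
  size_polyXn.
by lia.
Qed.

Lemma size_monomial c u v l : (size (const3 c * monomial u v l)%R <= l.+1)%N.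
Proof. by rewrite monomialE mul_polyC (leq_trans (size_scale_leq _ _)) //
  size_polyXn. Qed.

Lemma size_shear_monomial c u v l :
  (size (shear (-1) (const3 c * monomial u v l))%R <= (u + v).+1)%N.
Proof.
have szM m n (A B : {poly {poly {poly k}}}) :
    (size A <= m.+1)%N -> (size B <= n.+1)%N ->
      (size (A * B)%R <= (m + n).+1)%N.
  by move=> szA szB; rewrite (leq_trans (size_polyMleq _ _)) //; lia.
have szX m n (A : {poly {poly {poly k}}}) :
    (size A <= m.+1)%N -> (size (A ^+ n)%R <= (n * m).+1)%N.
  move=> szA; elim: n => [|n IHn]; first by rewrite expr0 size_poly1.
  by rewrite exprS mulSn szM.
have -> : shear (-1) (const3 c * monomial u v l) =
    const3 c * (v3 k ^+ u * (v2 k + const3 (-1) * v1 k * v3 k) ^+ v * v1 k ^+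
      l).
  by rewrite /monomial !rmorphM !rmorphXn /= shear1 shear2 shear3 shear_const.
have szC (a : {poly {poly k}}) : (size a%:P <= 1)%N by apply: size_polyC_leq1.
have sz3 : (size (v3 k) <= 2)%N by rewrite size_polyX.
apply: (szM 0%N (u + v)%N); first exact: szC.
rewrite -[in X in (_ <= X)%N](addn0 (u + v)%N); apply: (szM _ _).
  apply: (szM u v); first by rewrite -[in X in (_ <= X)%N](muln1 u);
    apply: (szX _ _).
  rewrite -[in X in (_ <= X)%N](muln1 v); apply: (szX _ _);
    rewrite (leq_trans (size_polyD _ _)) // geq_max.
  rewrite (leq_trans (szC _)) //=; apply: (szM 0%N 1%N) => //.
  by apply: (szM 0%N 0%N); apply: szC.
by rewrite -[in X in (_ <= X)%N](muln0 l); apply: (szX _ _); apply: szC.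
Qed.

(** A linear system with fewer equations than unknowns: for each line, the
    coefficients of (a - a0)^i x^w with i < t and w < m + t are prescribed to be
    zero; those with w >= m + t vanish by the staircase bound. *)
Lemma stepanov_polynomial (I : finType) (ln : I -> k * k) (S : {set I}) m e t :
    (#|S| * (t * (m + t)) < m * (e * e))%N ->
  exists Phi, [/\ Phi != 0, inner_deg_le e.-1 Phi, (size Phi <= (2 * e).-1)%N,
    (size (shear 1 Phi) <= m)%N & forall i, i \in S -> contact t (ln i) Phi].
Proof.
move=> ltJI.
pose M (j : 'I_m * ('I_e * 'I_e)) (r : {i | i \in S} * ('I_t * 'I_(m + t))) : k
  :=
  ((line_monomial (ln (val r.1)) j.2.1 j.2.2 j.1)`_r.2.1)`_r.2.2.
have [|c [j0 cj0] cM] := @underdetermined _ _ _ M.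
  by rewrite !card_prod !card_ord card_sig; apply: leq_trans ltJI;
    rewrite ltnS leqnn.
pose Psi := \sum_j const3 (c j) * monomial j.2.1 j.2.2 j.1.
have Psi_neq0 : Psi != 0.
  apply: contraNneq cj0 => Psi0.
  have : ((Psi`_j0.1)`_j0.2.2)`_j0.2.1 = c j0.
    rewrite /Psi !coef_sum (bigD1 j0) //= big1 => [|j nj].
      by rewrite coef_monomial !eqxx addr0 !mulr1.
    rewrite coef_monomial; case: j nj => [l [u v]]; case: j0 => [l0 [u0 v0]] /=.
    move=> nj; case: eqP => [/ord_inj eu|_]; last by rewrite mulr0 !mul0r.
    case: eqP => [/ord_inj ev|_]; last by rewrite mulr0 !mul0r.
    case: eqP => [/ord_inj el|_]; last by rewrite mulr0.
    by move: nj; rewrite eu ev el eqxx.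
  by rewrite Psi0 !coef0 => <-.
exists (shear (-1) Psi); split.
- by apply: contraNneq Psi_neq0 => Phi0; rewrite -[Psi]shearNK Phi0 rmorph0.
- apply/inner_deg_le_shear/inner_deg_le_sum => j _.
  exact/inner_deg_le_monomial.
- rewrite rmorph_sum (leq_trans (size_sum _ _ _)) //; apply/bigmax_leqP => j _.
  rewrite (leq_trans (size_shear_monomial _ _ _ _)) //.
  by have := ltn_ord j.2.1; have := ltn_ord j.2.2; lia.
- rewrite shearNK (leq_trans (size_sum _ _ _)) //; apply/bigmax_leqP => j _.
  exact: leq_trans (size_monomial _ _ _ _) (ltn_ord j.1).
move=> i iS; set s := ln i.
pose E := \sum_j (c j)%:P%:P * line_monomial s j.2.1 j.2.2 j.1.
have onE : on_line s (shear (-1) Psi) = E \Po ('X - s.1%:P%:P).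
  rewrite rmorph_sum rmorph_sum /E raddf_sum; apply: eq_bigr => j _ /=.
  rewrite rmorphM rmorphM /= on_line_monomial shear_const on_line_const.
  by rewrite [RHS]comp_polyM comp_polyC.
have Elow n : (n < t)%N -> E`_n = 0.
  move=> ltn; apply/polyP => w; rewrite coef0 !coef_sum.
  have [ltw|lew] := ltnP w (m + t).
    have := cM (exist _ i iS, (Ordinal ltn, Ordinal ltw)); apply: etrans.
    by apply: eq_bigr => j _; rewrite /M /= !coefCM.
  rewrite big1 // => j _; rewrite !coefCM nth_default ?mulr0 //.
  apply: leq_trans (staircase_line_monomial _ _ _ _ _) _.
  by have := ltn_ord j.1; lia.
have -> : contact t s (shear (-1) Psi) = (('X - s.1%:P%:P) ^+ t %| E \Po ('X -
  s.1%:P%:P)).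
  by rewrite /contact onE.
have -> : E = (\poly_(n < size E) E`_(n + t)) * 'X^t.
  apply/polyP => n; rewrite coefMXn; case: ltnP => [/Elow//|len].
  rewrite coef_poly subnK //; case: ltnP => // le; rewrite nth_default //.
  by rewrite (leq_trans le) // leq_subr.
by rewrite comp_polyM rmorphXn /= comp_polyX dvdp_mull.
Qed.

End Stepanov.

(** * Heavy points are few *)

Definition incident (F : fieldType) (P s : F * F) := P.2 == s.1 * P.1 + s.2.

(** The lines of [S] outside [S'] are those lost with common factors. *)
Lemma heavy_points (k : closedFieldType) (I : finType) (ln : I -> k * k)
    (S : {set I}) m e t :
    injective ln -> (0 < m)%N -> (0 < e)%N ->
    (forall i, (0 < i < maxn m (2 * e))%N -> i%:R != 0 :> k) ->
    (#|S| * (t * (m + t)) < m * (e * e))%N ->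
  exists S' : {set I}, [/\ S' \subset S, (#|S| < #|S'| + e)%N &
    forall Z : seq (k * k), uniq Z ->
      (forall P, P \in Z ->
         (2 * e <= t * #|[set i in S' | incident P (ln i)]|)%N) ->
      (size Z <= 3 * m * e)%N].
Proof.
move=> ln_inj m_gt0 e_gt0 char_k dim.
have [Phi [Phi_neq0 degPhi szPhi szsPhi SPhi]] := stepanov_polynomial ln dim.
have [Phi' [S' [B' [[nz' nf' sS' cS' deg'] [sz1 sz2 con']]]]] :=
  remove_common_factors ln_inj Phi_neq0 degPhi SPhi.
have leS' := subset_leq_card sS'.
exists S'; split=> //; first by lia.
move=> Z Z_uniq heavy.
have : (size Z <= (3 * m.-1).+1 * B')%N.
  apply: (few_zeros nz' deg') => //.
  - by rewrite (prednK m_gt0); exact: leq_trans sz2 szsPhi.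
  - move=> i /andP[i_gt0 lti]; apply: char_k; rewrite i_gt0 leq_max.
    apply/orP; right; apply: (leq_trans lti).
    exact: leq_trans sz1 (leq_trans szPhi (leq_pred _)).
  - move=> i /andP[i_gt0 lei]; apply: char_k; rewrite i_gt0 leq_max.
    by move: lei; rewrite -ltnS (prednK m_gt0) => ->.
  move=> P /heavy ltP; pose T := [set i in S' | incident P (ln i)].
  apply: (zero_of_contacts (m := t) (ss := [seq ln i | i <- enum T])).
  - by rewrite map_inj_uniq ?enum_uniq.
  - move=> s /mapP[i]; rewrite mem_enum inE => /andP[iS' /eqP Pi] ->.
    by split=> //; apply: con'.
  rewrite size_map -cardE.
  exact: leq_trans sz1 (leq_trans szPhi (leq_trans (leq_pred _) ltP)).
move/leq_trans; apply.
have : (B' <= e.-1)%N by lia.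
nia.
Qed.

(** * Incidences in a finite plane *)

Section Incidences.
Variable F : finFieldType.
Implicit Types (A H : {set F * F}) (S : {set F * F}) (P Q s : F * F).

Definition points_on A s := [set P in A | incident P s].
Definition lines_at S P := [set s in S | incident P s].
Definition rich A r := [set s | (r <= #|points_on A s|)%N].

Lemma card_setIdE (T : finType) (B : {set T}) (f : pred T) :
  #|[set x in B | f x]| = (\sum_(x in B) f x)%N.
Proof.
rewrite -sum1_card (eq_bigl (fun x => (x \in B) && f x)) => [|x];
  last by rewrite inE.
by rewrite big_mkcondr; apply: eq_bigr => x _; case: (f x).
Qed.

Lemma sum_points_on A S :
  (\sum_(s in S) #|points_on A s| = \sum_(P in A) #|lines_at S P|)%N.
Proof.
under eq_bigr => s _ do rewrite card_setIdE.
by rewrite exchange_big; apply: eq_bigr => P _; rewrite card_setIdE.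
Qed.

Lemma incident_inj P Q s s' : P != Q -> incident P s -> incident Q s ->
  incident P s' -> incident Q s' -> s = s'.
Proof.
case: P Q s s' => [x y] [x' y'] [a b] [a' b']; rewrite /incident /=.
move=> neq /eqP E0 /eqP E /eqP E1 /eqP E2; rewrite E0 in neq E1.
have neqx : x != x'.
  by apply: contraNneq neq => xx; rewrite xx E.
have aa' : a = a'.
  have -> : a = a' + (a - a') by ring.
  have : (a - a') * (x - x') =
      (a * x + b - (a' * x + b')) - (a * x' + b - (a' * x' + b')) by ring.
  rewrite E1 -E E2 !subrr => /eqP.
  by rewrite mulf_eq0 (subr_eq0 x) (negPf neqx) orbF => /eqP->; rewrite addr0.
by move: E1; rewrite aa' => /addrI->.
Qed.

Lemma card_points_on A s : (#|points_on A s| <= #|F|)%N.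
Proof.
rewrite -(card_in_imset (f := fst)) ?max_card // => [[x y] [x' y']].
by rewrite !inE /incident /= => /andP[_ /eqP->] /andP[_ /eqP->] ->.
Qed.

(** Two points determine a line, so the pairs of points on distinct lines are
    distinct. *)
Lemma pair_bound A r : (#|rich A r| * (r * (r - 1)) <= #|A| * #|A|)%N.
Proof.
pose T s := (\sum_(P in A) \sum_(Q in A) [&& Q != P,
  incident P s & incident Q s])%N.
have TE s : T s = (#|points_on A s| * (#|points_on A s| - 1))%N.
  rewrite -sum_nat_const [RHS](eq_bigl (fun P =>
    (P \in A) && incident P s)) => [|P];
    last by rewrite inE.
  rewrite big_mkcondr; apply: eq_bigr => P PA; case: ifP => Ps; last first.
    by rewrite big1 // => Q _; rewrite andbF.
  rewrite (cardsD1 P (points_on A s)) inE PA Ps addKn.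
  have -> : points_on A s :\ P = [set Q in A | (Q != P) && incident Q s].
    by apply/setP => Q; rewrite !inE andbCA.
  by rewrite card_setIdE.
apply: (@leq_trans (\sum_(s in rich A r) T s)%N).
  rewrite -sum_nat_const; apply: leq_sum => s; rewrite inE TE => ler.
  by rewrite leq_mul // leq_sub2r.
rewrite /T exchange_big -sum_nat_const; apply: leq_sum => P _.
rewrite exchange_big -[leqRHS]sum1_card; apply: leq_sum => Q _.
have [->|neq] := eqVneq Q P; first by rewrite big1.
rewrite -(card_setIdE (rich A r) (fun s => incident P s && incident Q s)).
rewrite leqNgt; apply/card_gt1P => -[s [s' []]].
rewrite !inE => /and3P[_ Ps Qs] /and3P[_ Ps' Qs'] /eqP; apply.
by apply: (incident_inj (P := P) (Q := Q)) => //; rewrite eq_sym.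
Qed.

End Incidences.

(** * Szemeredi-Trotter over the prime field *)

(** The choices are e = 7 n / r, m = r / 1024 and t = 4 n e / (r L) + 1, rounded
    down. Then L t is about 4 n e / r + L, where L is at most about n^2 / r^2 by
    the pair bound; with n / r about e / 7 the sum is safely below e^2. If L r^3
    exceeds C n^2 then 8 t <= m, so that t (m + t) is close to t m. *)
Lemma stepanov_parameters C n r L p : (1024 * 1024 <= C)%N -> (2 <= r)%N ->
    (r <= n)%N -> (r <= p)%N -> (16 * n <= r * p)%N ->
    (C * (n ^ 2 + n * r ^ 2) < L * r ^ 3)%N -> (L * (r * (r - 1)) <= n * n)%N ->
  exists m e t, [/\ (0 < m)%N, (0 < e)%N,
    (maxn m (2 * e) <= p)%N & (4 <= r)%N] /\
    [/\ (L * (t * (m + t)) < m * (e * e))%N, (32 * (3 * m * e) <= n)%N,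
     (8 * e <= L)%N & (4 * n * e < t * r * L)%N].
Proof.
move=> C_big r_ge2 ler_n ler_p r_big L_big pairs.
have L_gt0 : (0 < L)%N by case: (L) L_big.
have n_gt0 : (0 < n)%N by lia.
have Cn : (C * n ^ 2 < L * r ^ 3)%N.
  by apply: leq_ltn_trans L_big; rewrite leq_mul2l leq_addr orbT.
have CLr : (C * n < L * r)%N.
  rewrite -(@ltn_pmul2r (r ^ 2)) ?expn_gt0; last by lia.
  apply: leq_ltn_trans (leq_trans L_big _); last by rewrite -mulnA -expnS.
  by rewrite -mulnA leq_mul2l leq_addl orbT.
(* Comparison of L r^3 > C n^2 with the pair bound. It makes the rounding errors
   in [m] negligible. *)
have r_gt : (512 * 1024 < r)%N.
  have H1 : (C * n ^ 2 * (r - 1) < L * r ^ 3 * (r - 1))%N.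
    by rewrite ltn_pmul2r // subn_gt0.
  have H2 : (L * r ^ 3 * (r - 1) = L * (r * (r - 1)) * r ^ 2)%N.
    by rewrite !expnS expn0; lia.
  have H3 : (L * (r * (r - 1)) * r ^ 2 <= n ^ 2 * r ^ 2)%N.
    by rewrite leq_mul2r -mulnn pairs orbT.
  have H4 : (C * (r - 1) < r ^ 2)%N.
    rewrite -(@ltn_pmul2l (n ^ 2)) ?expn_gt0 ?n_gt0 //.
    by apply: leq_trans H3; rewrite -H2; apply: leq_trans H1;
      rewrite -mulnA mulnCA.
  have H5 : (r ^ 2 <= (r - 1) * (2 * r))%N by rewrite -mulnn mulnA leq_mul2r;
    lia.
  have : ((r - 1) * C < (r - 1) * (2 * r))%N by rewrite mulnC (leq_trans H4).
  by rewrite ltn_pmul2l ?subn_gt0 //; lia.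
pose e := (7 * n %/ r)%N; pose m := (r %/ 1024)%N;
  pose t := (4 * n * e %/ (r * L)).+1.
have r_gt0 : (0 < r)%N by lia.
have rL_gt0 : (0 < r * L)%N by rewrite muln_gt0 r_gt0.
have e_le : (e * r <= 7 * n)%N by apply: leq_divM.
have e_gt : (6 * n < e * r)%N.
  by have := ltn_ceil (7 * n) r_gt0; rewrite -/e mulSn; lia.
have m_le : (m * 1024 <= r)%N by apply: leq_divM.
have m_gt : (r < (m.+1) * 1024)%N by apply: ltn_ceil.
have t_le : (t.-1 * (r * L) <= 4 * n * e)%N by apply: leq_divM.
have t_gt : (4 * n * e < t * (r * L))%N by apply: ltn_ceil.
have e_gt0 : (0 < e)%N by case: (e) e_gt.
have m_gt0 : (0 < m)%N by lia.
have t_small : (8 * t <= m)%N.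
  suff : (t.-1 * (1024 * 1024) <= 28 * r)%N by lia.
  apply: (@leq_trans (t.-1 * C)); first by rewrite leq_mul2l C_big orbT.
  rewrite -(@leq_pmul2r (n ^ 2)) ?expn_gt0 ?n_gt0 //.
  apply: (@leq_trans (t.-1 * (r * L) * r ^ 2)).
    rewrite -mulnA -[leqRHS]mulnA leq_mul2l; apply/orP; right.
    by apply: leq_trans (ltnW Cn) _; rewrite !expnS; lia.
  apply: (@leq_trans (4 * n * e * r ^ 2)); first by rewrite leq_mul2r t_le orbT.
  have -> : (4 * n * e * r ^ 2 = e * r * (4 * n * r))%N by rewrite -mulnn; lia.
  apply: (@leq_trans (7 * n * (4 * n * r)));
    first by rewrite leq_mul2r e_le orbT.
  by rewrite -mulnn; lia.
exists m, e, t; split; split=> //.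
- rewrite geq_max; apply/andP; split; first by lia.
  by rewrite -(@leq_pmul2r r) //; lia.
- by lia.
- have H1 : (9 * (L * t) < 8 * (e * e))%N.
    rewrite -(@ltn_pmul2r r) //.
    have tL : (L * t * r <= 4 * n * e + r * L)%N by move: t_le; rewrite /t /=;
      lia.
    have H2 : (6 * (n * e) < e * e * r)%N.
      have : (e * (6 * n) < e * (e * r))%N by rewrite ltn_pmul2l.
      by lia.
    have H3 : (36 * L * (r - 1) < e * e * r)%N.
      rewrite -(@ltn_pmul2r r) //.
      have : (6 * n * (6 * n) < e * r * (e * r))%N by apply: ltn_mul.
      by move: pairs; lia.
    have H4 : (r * L <= 2 * (L * (r - 1)))%N.
      by rewrite mulnCA mulnC leq_mul2l; apply/orP; right; lia.
    by lia.
  have : (8 * (L * (t * (m + t))) <= 9 * (L * t) * m)%N.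
    have : (L * t * (8 * t) <= L * t * m)%N by rewrite leq_mul2l t_small orbT.
    by lia.
  have : (9 * (L * t) * m < 8 * (e * e) * m)%N by rewrite ltn_pmul2r.
  by lia.
- rewrite -(@leq_pmul2r r) //.
  have : (m * 1024 * (e * r) <= r * (7 * n))%N by apply: leq_mul.
  by lia.
- have : (8 * e * C <= L * C)%N.
    rewrite -(@leq_pmul2r r) //.
    have : (C * (e * r) <= C * (7 * n))%N by rewrite leq_mul2l e_le orbT.
    have : (1024 * 1024 * (L * r) <= C * (L * r))%N by rewrite leq_mul2r C_big
      orbT.
    by lia.
  by rewrite leq_pmul2r //; lia.
by move: t_gt; rewrite mulnA.
Qed.

Lemma descent_arithmetic C L L' n n' r r' : (L <= 8 * L')%N ->
    (L' * r' ^ 3 <= C * (n' ^ 2 + n' * r' ^ 2))%N -> (32 * n' <= n)%N ->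
    (r <= 4 * r')%N -> (0 < r')%N ->
  (L * r ^ 3 <= C * (n ^ 2 + n * r ^ 2))%N.
Proof.
move=> leL leL' len ler r'_gt0.
rewrite -(@leq_pmul2r (r' ^ 3)) ?expn_gt0 ?r'_gt0 //.
have r3 : (r ^ 3 <= 64 * r' ^ 3)%N.
  by rewrite (_ : 64 = 4 ^ 3)%N // -expnMn leq_exp2r.
have n2 : (1024 * n' ^ 2 <= n ^ 2)%N.
  by rewrite (_ : 1024 = 32 ^ 2)%N // -expnMn leq_exp2r.
have H1 : (8 * n' ^ 2 * r ^ 3 <= n ^ 2 * r' ^ 3)%N.
  have := leq_mul (leqnn (n' ^ 2)) r3; have := leq_mul n2 (leqnn (r' ^ 3)).
  by lia.
have H2 : (8 * (n' * r' ^ 2) * r ^ 3 <= n * r ^ 2 * r' ^ 3)%N.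
  have := leq_mul (leqnn (n' * r' ^ 2 * r ^ 2)) ler.
  have := leq_mul len (leqnn (r ^ 2 * r' ^ 3)).
  by rewrite [(r ^ 3)%N]expnS [(r' ^ 3)%N]expnS; lia.
apply: (@leq_trans (8 * (L' * r' ^ 3) * r ^ 3)).
  by have := leq_mul leL (leqnn (r ^ 3 * r' ^ 3)); lia.
apply: (@leq_trans (8 * (C * (n' ^ 2 + n' * r' ^ 2)) * r ^ 3)).
  by rewrite leq_mul2r leq_mul2l leL' !orbT.
by have := leq_mul (leqnn C) (leq_add H1 H2); lia.
Qed.

Section PrimeField.
Variables (p : nat) (p_prime : prime p).
Let F : finFieldType := 'F_p.
Implicit Types (A H : {set F * F}) (S : {set F * F}) (P s : F * F).

(** The algebraic closure provides the roots used for Gauss's lemma and the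
    infinitely many generic values. *)
Lemma heavy_points_Fp S m e t : (0 < m)%N -> (0 < e)%N ->
  (maxn m (2 * e) <= p)%N ->
    (#|S| * (t * (m + t)) < m * (e * e))%N ->
  exists S' : {set F * F}, [/\ S' \subset S, (#|S| < #|S'| + e)%N &
    forall H, (forall P, P \in H -> (2 * e <= t * #|lines_at S' P|)%N) ->
      (#|H| <= 3 * m * e)%N].
Proof.
move=> m_gt0 e_gt0 lep dim.
have [k [iota _]] := countable_algebraic_closure F.
pose emb (P : F * F) : k * k := (iota P.1, iota P.2).
have emb_inj : injective emb.
  by move=> [x y] [x' y'] [/fmorph_inj-> /fmorph_inj->].
have emb_inc P s : incident (emb P) (emb s) = incident P s.
  by rewrite /incident /= -rmorphM -rmorphD (inj_eq (fmorph_inj iota)).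
have char_k i : (0 < i < maxn m (2 * e))%N -> i%:R != 0 :> k.
  move=> /andP[i_gt0 lti]; rewrite -(rmorph_nat iota) fmorph_eq0.
  rewrite -(dvdn_pcharf (pchar_Fp p_prime)) gtnNdvd //.
  exact: leq_trans lti lep.
have [S' [sS' cS' few]] := heavy_points emb_inj m_gt0 e_gt0 char_k dim.
exists S'; split=> // H heavy; rewrite cardE -(size_map emb); apply: few.
  by rewrite map_inj_uniq ?enum_uniq.
move=> Q /mapP[P]; rewrite mem_enum => PH ->.
have -> : [set i in S' | incident (emb P) (emb i)] = lines_at S' P.
  by apply/setP => s; rewrite !inE emb_inc.
exact: heavy.
Qed.

(** The small set consists of the heavy points. A rich line with at most r / 4
    heavy points has at least 3 r / 4 light ones, and each light point is on
    fewer than 2 e / t lines. *)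
Lemma rich_on_small_subset C A r : (1024 * 1024 <= C)%N -> (2 <= r)%N ->
    (16 * #|A| <= r * p)%N -> (C * (#|A| ^ 2 + #|A| * r ^ 2) < #|rich A r| * r
      ^ 3)%N ->
  (4 <= r <= #|A|)%N /\ exists2 H : {set F * F}, (32 * #|H| <= #|A|)%N &
    (#|rich A r| <= 8 * #|rich H (r %/ 4).+1|)%N.
Proof.
move=> C_big r_ge2 r_big L_big.
have [s0 s0S] : exists s, s \in rich A r.
  by apply/card_gt0P; case: (#|rich A r|) L_big.
have [ler_n ler_p] : (r <= #|A|)%N /\ (r <= p)%N.
  move: s0S; rewrite inE => le; split; apply: leq_trans le _.
    by apply: subset_leq_card; apply/subsetP => P; rewrite inE => /andP[].
  by rewrite (leq_trans (card_points_on _ _)) // card_Fp.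
have [m [e [t [[m_gt0 e_gt0 lep r_ge4] [dim small e_le t_big]]]]] :=
  stepanov_parameters C_big r_ge2 ler_n ler_p r_big L_big (pair_bound A r).
have [S' [sS' cS' few]] := heavy_points_Fp m_gt0 e_gt0 lep dim.
pose H := [set P in A | (2 * e <= t * #|lines_at S' P|)%N].
split; first by rewrite r_ge4.
exists H.
  by apply: leq_trans small; rewrite leq_mul2l few // => P;
    rewrite inE => /andP[].
pose r' := (r %/ 4).+1; rewrite -/r'; pose bad := S' :\: rich H r'.
have good_le : (#|S'| <= #|bad| + #|rich H r'|)%N.
  by rewrite -(cardsID (rich H r') S') addnC leq_add2l subset_leq_card //
    subsetIr.
have light s : s \in bad -> (r <= #|points_on (A :\: H) s| + r %/ 4)%N.
  rewrite !inE -ltnNge ltnS => /andP[few_heavy sS].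
  have := subsetP sS' _ sS; rewrite inE => /leq_trans; apply.
  rewrite -(cardsID H (points_on A s)) addnC leq_add //.
    by apply: subset_leq_card; apply/subsetP => P; rewrite !inE andbA.
  apply: leq_trans few_heavy; apply: subset_leq_card.
  by apply/subsetP => P; rewrite !inE => /andP[/andP[_ ->] ->].
have bad_le : (t * (#|bad| * (r - r %/ 4)) <= 2 * e * #|A|)%N.
  apply: (@leq_trans (t * \sum_(s in bad) #|points_on (A :\: H) s|)).
    rewrite leq_mul2l -sum_nat_const; apply/orP; right;
      apply: leq_sum => s /light.
    by rewrite leq_subLR addnC.
  rewrite sum_points_on big_distrr /=.
  apply: (@leq_trans (\sum_(P in A :\: H) 2 * e)%N).
    apply: leq_sum => P; rewrite !inE => /andP[+ PA];
      rewrite PA /= -ltnNge => /ltnW.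
    apply: leq_trans; rewrite leq_mul2l; apply/orP; right;
      apply: subset_leq_card.
    by apply/subsetP => s; rewrite !inE => /andP[/andP[_ ->] ->].
  by rewrite sum_nat_const mulnC leq_mul2l subset_leq_card ?orbT ?subsetDl.
have bad_small : (3 * #|bad| <= 2 * #|rich A r|)%N.
  have tr_gt0 : (0 < t * r)%N.
    by case: (t * r)%N t_big => [|n]; rewrite ?mul0n.
  rewrite -(@leq_pmul2l (t * r)) //.
  have : (t * #|bad| * (3 * r) <= t * #|bad| * (4 * (r - r %/ 4)))%N.
    by rewrite leq_mul2l; apply/orP; right; lia.
  by lia.
move: good_le bad_small cS' e_le.
by move: #|S'| #|bad| #|rich H r'| #|rich A r| => *; lia.
Qed.

(** Passing to the small subset divides |A| by at least 32, but r and the number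
    of lines by at most 4 and 8; so a counterexample produces a smaller one. *)
Lemma szemeredi_trotter_Fp C A r : (1024 * 1024 <= C)%N -> (2 <= r)%N ->
    (16 * #|A| <= r * p)%N ->
  (#|rich A r| * r ^ 3 <= C * (#|A| ^ 2 + #|A| * r ^ 2))%N.
Proof.
move=> C_big; have [n] := ubnP #|A|;
  elim: n A r => // n IHn A r ltn r_ge2 r_big.
rewrite leqNgt; apply/negP => L_big.
have [/andP[r_ge4 ler_n] [H H_small L_le]] :=
  rich_on_small_subset C_big r_ge2 r_big L_big.
set r' := (r %/ 4).+1 in L_le.
have r_lt : (r <= 4 * r')%N by rewrite /r'; lia.
have r'_ge2 : (2 <= r')%N by rewrite /r'; lia.
have ltH : (#|H| < n)%N by lia.
have r'_big : (16 * #|H| <= r' * p)%N.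
  have : (r * p <= 4 * r' * p)%N by rewrite leq_mul2r r_lt orbT.
  by lia.
have IH := IHn H r' ltH r'_ge2 r'_big.
move: L_big; apply/negP; rewrite -leqNgt.
exact: descent_arithmetic L_le IH H_small r_lt (ltnW r'_ge2).
Qed.

End PrimeField.

(** * Lines as point sets *)

Section Transfer.
Variable F : finFieldType.
Implicit Types (A l : {set 'rV[F]_2}) (v w : 'rV[F]_2).

Definition coords v : F * F := (v 0 0, v 0 1).

Lemma coords_inj : injective coords.
Proof.
move=> v w [e0 e1]; apply/rowP => i.
have [->|->] // : i = 0 \/ i = 1.
by case: i => [[|[|//]] lti]; [left|right]; apply: val_inj.
Qed.

Definition slanted s : {set 'rV[F]_2} := [set w | incident (coords w) s].
Definition vertical x : {set 'rV[F]_2} := [set w | (coords w).1 == x].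

Lemma affine_lineP l : affine_line l ->
  (exists s, l = slanted s) \/ (exists x, l = vertical x).
Proof.
case/existsP => a /existsP[v /andP[v_neq0 /eqP ->]].
have [v0|v0] := eqVneq (v 0 0) 0; [right; exists (a 0 0)|left].
  have v1 : v 0 1 != 0.
    by apply: contraNneq v_neq0 => v1; apply/eqP/coords_inj;
      rewrite /coords v0 v1 !mxE.
  apply/setP => w; rewrite inE; apply/imsetP/eqP => [[t _ ->]|/= wa].
    by rewrite /= !mxE v0 mulr0 addr0.
  exists ((w 0 1 - a 0 1) / v 0 1) => //; apply: coords_inj;
    rewrite /coords !mxE.
  by rewrite v0 mulr0 addr0 wa divfK // addrC subrK.
exists (v 0 1 / v 0 0, a 0 1 - v 0 1 / v 0 0 * a 0 0).
apply/setP => w; rewrite inE; apply/imsetP/eqP => [[t _ ->]|/= wa].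
  by rewrite /= !mxE; field.
exists ((w 0 0 - a 0 0) / v 0 0) => //; apply: coords_inj;
  rewrite /coords !mxE wa.
by congr (_, _); field.
Qed.

Lemma card_rich_lines A r : (0 < r)%N ->
  (#|[set l | affine_line l & (r <= #|A :&: l|)%N]| * r <=
     #|rich (coords @: A) r| * r + #|A|)%N.
Proof.
move=> r_gt0; pose X := [set x | (r <= #|[set v in A | (coords v).1 == x]|)%N].
have X_le : (#|X| * r <= #|A|)%N.
  rewrite -sum_nat_const.
  apply: (@leq_trans (\sum_(x in X) #|[set v in A | (coords v).1 == x]|)).
    by apply: leq_sum => x; rewrite inE.
  under eq_bigr => x _ do rewrite card_setIdE.
  rewrite exchange_big -sum1_card; apply: leq_sum => v _.
  rewrite -(card_setIdE X (fun x => (coords v).1 == x)).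
  apply: (@leq_trans #|[set (coords v).1]|); last by rewrite cards1.
  apply: subset_leq_card.
  by apply/subsetP => x; rewrite !inE => /andP[_ /eqP->].
have sub : [set l | affine_line l & (r <= #|A :&: l|)%N] \subset
    (slanted @: rich (coords @: A) r) :|: (vertical @: X).
  apply/subsetP => l; rewrite !inE => /andP[/affine_lineP[[s ->]|[x ->]] le].
    apply/orP; left; apply: imset_f; rewrite inE (leq_trans le) //.
    rewrite -(card_imset _ coords_inj); apply: subset_leq_card.
    apply/subsetP => P /imsetP[v]; rewrite !inE => /andP[vA vs] ->.
    by rewrite imset_f.
  apply/orP; right; apply: imset_f; rewrite inE (leq_trans le) //.
  by apply: subset_leq_card; apply/subsetP => v; rewrite !inE.
apply: (@leq_trans (#|rich (coords @: A) r| * r + #|X| * r)); last first.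
  by rewrite leq_add2l.
rewrite -mulnDl leq_mul2r; apply/orP; right.
apply: leq_trans (subset_leq_card sub) (leq_trans (leq_card_setU _ _) _).
by rewrite leq_add // leq_imset_card.
Qed.

End Transfer.

Theorem theorem1p2 (R : realType) :
  exists C : R, 0 < C /\
    forall (p : nat), prime p -> (2 < p)%N ->
    forall (A : {set 'rV['F_p]_2}) (r : R),
      2%:R <= r -> r <= #|A|%:R ->
      Num.max 2%:R (16%:R * #|A|%:R / p%:R) <= r ->
      #|rich_lines A r|%:R <= C * (#|A|%:R ^+ 2 / r ^+ 3 + #|A|%:R / r).
Proof.
have [C C_big] : exists C, (1024 * 1024 <= C)%N by exists (1024 * 1024)%N;
  exact: leqnn.
exists (C.+1)%:R; split=> [|p p_prime _ A r r_ge2 _]; first by rewrite ltr0n.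
rewrite ge_max => /andP[_ r_big].
have r_gt0 : 0 < r by apply: lt_le_trans r_ge2; rewrite ltr0n.
pose q := `|Num.ceil r|%N.
have qE : (q%:R : R) = (Num.ceil r)%:~R.
  by rewrite /q natr_absz ger0_norm // -(ler_int R) (le_trans (ltW r_gt0)) //
    ceil_ge.
have ler_q n : (r <= n%:R) = (q <= n)%N.
  by rewrite -(ler_nat R) qE -[n%:R]/(n%:~R) ler_int ceil_le_int.
have r_le : r <= q%:R by rewrite ler_q.
have q_ge2 : (2 <= q)%N by rewrite -(ler_nat R) (le_trans r_ge2).
have q_big : (16 * #|A| <= q * p)%N.
  rewrite -(ler_nat R) !natrM.
  have p_gt0 : 0 < p%:R :> R by rewrite ltr0n prime_gt0.
  by rewrite -ler_pdivrMr // (le_trans r_big).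
have -> : rich_lines A r = [set l | affine_line l & (q <= #|A :&: l|)%N].
  by apply/setP => l; rewrite !inE ler_q.
have q_gt0 : (0 < q)%N by apply: leq_trans q_ge2.
have := card_rich_lines A q_gt0; set L := #|_|.
have := @szemeredi_trotter_Fp p p_prime C (@coords _ @: A) q C_big q_ge2.
rewrite (card_imset _ (@coords_inj _)) => /(_ q_big).
set N := #|rich _ _|; set n := #|A|; move: N L n => N L n ST split.
have : (L * q ^ 3 <= C.+1 * (n ^ 2 + n * q ^ 2))%N.
  have H : (L * q * q ^ 2 <= (N * q + n) * q ^ 2)%N by rewrite leq_mul2r split
    orbT.
  by move: H; rewrite expnS; lia.
rewrite -(ler_nat R) !natrM natrD natrM !natrX => main.
have n_ge0 : 0 <= n%:R :> R by rewrite ler0n.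
have q_pos : 0 < q%:R :> R by rewrite ltr0n.
apply: (@le_trans _ _ (C.+1%:R * (n%:R ^+ 2 / q%:R ^+ 3 + n%:R / q%:R))).
  rewrite -(ler_pM2r (x := q%:R ^+ 3)) ?exprn_gt0 //; apply: le_trans main _.
  rewrite le_eqVlt; apply/orP; left; apply/eqP; field.
  by rewrite lt0r_neq0.
rewrite ler_pM2l ?ltr0n // lerD // ler_wpM2l ?exprn_ge0 //
  lef_pV2 ?posrE ?exprn_gt0 //.
by rewrite lerXn2r // nnegrE ltW.
Qed.
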